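(* Let $s=\sigma+it$ with $\sigma>0$ fixed and $t$ real. Then $$\int_{-\infty}^{\infty}\left|\frac{(1-2^{1-s})\zeta(s)}{s}\right|^2\,dt=\frac{\pi}{\sigma}\,(1-2^{1-2\sigma})\,\zeta(2\sigma).$$
   Context: $\zeta(s)$ denotes the Riemann zeta-function. The function $(1-2^{1-w})\zeta(w)$ is entire (the removable singularity at $w=1$ having value $\log 2$), so the right-hand side at $\sigma=\tfrac12$ is understood as $\frac{\pi}{\sigma}\log 2=2\pi\log 2$. *)

(* Defs.v *)
From Stdlib Require Import Reals ClassicalEpsilon.
From Coquelicot Require Import Coquelicot.

Open Scope R_scope.

Definition Cexp (z : C) : C := (exp (Re z) * cos (Im z), exp (Re z) * sin (Im z)).

(* [x] raised to the complex power [w], principal value; meaningful for 0 < x only. *)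
Definition Rpow_C (x : R) (w : C) : C := Cexp (w * RtoC (ln x))%C.

(* Coquelicot's power series over C are series of [(z - s)^n * a n] with complex [a n]. *)
Definition analytic_at (f : C -> C) (s : C) : Prop :=
  exists a : nat -> C,
    locally (T := C_UniformSpace) s
      (fun z => is_pseries (K := C_AbsRing) (V := C_NormedModule) a (z - s)%C (f z)).

(* [f] is an analytic continuation of the Dirichlet series of zeta to the half-plane
   Re s > a with the pole 1 removed.  The series index starts at 0, hence [S n]. *)
Definition zeta_continuation (a : R) (f : C -> C) : Prop :=
  (forall s : C, 1 < Re s ->
     is_series (K := C_AbsRing) (V := C_NormedModule)
       (fun n : nat => Rpow_C (INR (S n)) (- s)%C) (f s)) /\
  (forall s : C, a < Re s -> s <> RtoC 1 -> analytic_at f s).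

(* The Riemann zeta-function.  For s <> 1 a continuation to some half-plane Re > a
   containing s exists, and by the identity theorem its value at s depends neither on a
   nor on f, so that [epsilon] has exactly one value to choose.  The value at the
   pole 1 is arbitrary. *)
Definition zeta (s : C) : C :=
  epsilon (inhabits (RtoC 0))
    (fun v => exists (a : R) (f : C -> C),
       a < Re s /\ zeta_continuation a f /\ v = f s).

(* The entire function (1 - 2^(1-w)) zeta(w), whose value at the removable singularity
   w = 1 is log 2. *)
Definition one_sub_two_pow_mul_zeta (w : C) : C :=
  if Ceq_dec w (RtoC 1) then RtoC (ln 2)
  else ((RtoC 1 - Rpow_C 2 (RtoC 1 - w)) * zeta w)%C.

(* Main.v *)
(* Write eta(s) = sum (-1)^(n-1) n^(-s), which converges to (1-2^(1-s)) zeta(s) on Re s > 0, and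
   let P_N be its partial sums.  Since the integral of cos(bt)/(sigma^2+t^2) over R is
   (pi/sigma) e^(-sigma|b|), expanding |P_N(sigma+it)|^2 gives the exact identity
     int |P_N(s)/s|^2 dt = (pi/sigma) sum_{m,n<=N} (-1)^(m+n) max(m,n)^(-2 sigma)
                         = (pi/sigma) sum_{n<=N} (-1)^(n-1) n^(-2 sigma),
   and likewise for every block of consecutive terms.  Hence the even partial sums P_N/s are
   Cauchy in L^2; they also converge uniformly in t, so the identity passes to the limit.

   For Re s > 0 the continuation of zeta is the limit of
   sum_{n<=N} n^(-s) + (N+1)^(1-s)/(s-1), and P_{2N}(s) = S_{2N}(s) - 2^(1-s) S_N(s) for
   S_N(s) = sum_{n<=N} n^(-s), which identifies the limit of P_{2N} with (1-2^(1-s)) zeta(s). *)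

Require Import Defs.
From Stdlib Require Import Reals.
From Coquelicot Require Import Coquelicot.
Open Scope R_scope.
From Stdlib Require Import Factorial Lra Lia ClassicalEpsilon Classical.

(** * Finite sums and limits of complex sequences *)

(** The value chosen by [zeta] is known only once a continuation exists and any two agree. Existence
    comes from the telescoped series [zeta_term], analytic because absolutely convergent power
    series are closed under sums and products. Uniqueness restricts to straight lines that avoid the
    pole, where real power series decide it.

    The cosine transform is found without contours: truncated to [-T, T] it solves a linear ODE in
    the frequency with a rapidly oscillating forcing term, and T tends to infinity afterwards. The
    maximum arises as (m n)^(-sigma) exp(-sigma |ln m - ln n|) = max(m,n)^(-2 sigma), and the double
    sum collapses because partial sums of the signs are 0 or 1.

    The obstacle in the last limit is that the bound |P_N(s)/s| <= 1/sigma for even N, although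
    uniform in t, is not square integrable on the line. It yields convergence of the integrals on
    bounded intervals only. The mean square of a block, at most pi/sigma times the square of its
    first coefficient whatever its length, then rules out a loss of mass at infinity. *)

Fixpoint rsum (f : nat -> R) (n : nat) : R :=
  match n with O => 0 | S m => rsum f m + f m end.

Fixpoint csum (f : nat -> C) (n : nat) : C :=
  match n with O => RtoC 0 | S m => (csum f m + f m)%C end.

(** Encoded through moduli so that squeeze arguments for real sequences apply directly;
    [filterlim_clim] ties it to the filter notion. *)
Definition clim (u : nat -> C) (l : C) : Prop :=
  is_lim_seq (fun n => Cmod (u n - l)%C) 0.

Lemma rsum_ext (f g : nat -> R) (n : nat) :
  (forall k, (k < n)%nat -> f k = g k) -> rsum f n = rsum g n.
Proof.
  induction n as [|n IH]; intros H; simpl; [reflexivity|].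
  rewrite IH by (intros; apply H; lia). rewrite H by lia. reflexivity.
Qed.

Lemma rsum_le (f g : nat -> R) (n : nat) :
  (forall k, (k < n)%nat -> f k <= g k) -> rsum f n <= rsum g n.
Proof.
  induction n as [|n IH]; intros H; simpl; [lra|].
  apply Rplus_le_compat; [apply IH; intros; apply H; lia | apply H; lia].
Qed.

Lemma rsum_nonneg (f : nat -> R) (n : nat) :
  (forall k, 0 <= f k) -> 0 <= rsum f n.
Proof. intros H; induction n as [|n IH]; simpl; [lra|]. specialize (H n); lra. Qed.

Lemma rsum_scal (c : R) (f : nat -> R) (n : nat) :
  rsum (fun k => c * f k) n = c * rsum f n.
Proof. induction n as [|n IH]; simpl; [ring|rewrite IH; ring]. Qed.

Lemma rsum_plus (f g : nat -> R) (n : nat) :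
  rsum (fun k => f k + g k) n = rsum f n + rsum g n.
Proof. induction n as [|n IH]; simpl; [ring|rewrite IH; ring]. Qed.

Lemma rsum_shift (f : nat -> R) (n : nat) :
  rsum f (S n) = f O + rsum (fun k => f (S k)) n.
Proof. induction n as [|n IH]; [simpl; ring|]. simpl in *. rewrite IH. ring. Qed.

Lemma rsum_swap (f : nat -> nat -> R) (n m : nat) :
  rsum (fun i => rsum (f i) m) n = rsum (fun j => rsum (fun i => f i j) n) m.
Proof.
  induction n as [|n IH]; simpl.
  - induction m as [|m IHm]; simpl; [reflexivity|rewrite <- IHm; ring].
  - rewrite IH. rewrite <- rsum_plus. apply rsum_ext; reflexivity.
Qed.

Lemma csum_ext (f g : nat -> C) (n : nat) :
  (forall k, (k < n)%nat -> f k = g k) -> csum f n = csum g n.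
Proof.
  induction n as [|n IH]; intros H; simpl; [reflexivity|].
  rewrite IH by (intros; apply H; lia). rewrite H by lia. reflexivity.
Qed.

Lemma csum_plus (f g : nat -> C) (n : nat) :
  csum (fun k => f k + g k)%C n = (csum f n + csum g n)%C.
Proof. induction n as [|n IH]; simpl; [ring|rewrite IH; ring]. Qed.

Lemma csum_scal (c : C) (f : nat -> C) (n : nat) :
  csum (fun k => c * f k)%C n = (c * csum f n)%C.
Proof. induction n as [|n IH]; simpl; [ring|rewrite IH; ring]. Qed.

Lemma csum_shift (f : nat -> C) (n : nat) :
  csum f (S n) = (f O + csum (fun k => f (S k)) n)%C.
Proof. induction n as [|n IH]; [simpl; ring|]. simpl in *. rewrite IH. ring. Qed.

Lemma Cmod_csum (f : nat -> C) (n : nat) :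
  Cmod (csum f n) <= rsum (fun k => Cmod (f k)) n.
Proof.
  induction n as [|n IH]; simpl; [rewrite Cmod_0; lra|].
  eapply Rle_trans; [apply Cmod_triangle|lra].
Qed.

Lemma sum_n_csum (a : nat -> C) (n : nat) :
  sum_n (G := C_AbelianMonoid) a n = csum a (S n).
Proof.
  induction n as [|n IH].
  - rewrite sum_O. simpl. ring.
  - rewrite sum_Sn, IH. reflexivity.
Qed.

Lemma Cmod_sym (x y : C) : Cmod (x - y)%C = Cmod (y - x)%C.
Proof. rewrite <- Cmod_opp. f_equal. ring. Qed.

Lemma clim_spec (u : nat -> C) (l : C) :
  clim u l <-> forall eps, 0 < eps -> exists N, forall n, (N <= n)%nat -> Cmod (u n - l)%C < eps.
Proof.
  unfold clim. rewrite <- is_lim_seq_spec. unfold is_lim_seq'. split.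
  - intros H eps He. destruct (H (mkposreal eps He)) as [N HN]. exists N. intros n Hn.
    specialize (HN n Hn). simpl in HN. rewrite Rminus_0_r in HN.
    rewrite Rabs_pos_eq in HN by apply Cmod_ge_0. exact HN.
  - intros H eps. destruct (H eps (cond_pos eps)) as [N HN]. exists N. intros n Hn.
    rewrite Rminus_0_r, Rabs_pos_eq by apply Cmod_ge_0. apply HN, Hn.
Qed.

Lemma clim_le (u : nat -> C) (l : C) (v : nat -> R) :
  (forall n, Cmod (u n - l)%C <= v n) -> is_lim_seq v 0 -> clim u l.
Proof.
  intros H Hv. apply is_lim_seq_le_le with (fun _ => 0) v; auto.
  - intros n; split; [apply Cmod_ge_0|apply H].
  - apply is_lim_seq_const.
Qed.

Lemma clim_ext (u v : nat -> C) (l : C) :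
  (forall n, u n = v n) -> clim u l -> clim v l.
Proof. intros H. apply is_lim_seq_ext. intros n. now rewrite H. Qed.

Lemma clim_const (c : C) : clim (fun _ => c) c.
Proof.
  apply clim_le with (fun _ => 0); [|apply is_lim_seq_const].
  intros _. replace (c - c)%C with (RtoC 0) by ring. rewrite Cmod_0; lra.
Qed.

Lemma clim_plus (u v : nat -> C) (l m : C) :
  clim u l -> clim v m -> clim (fun n => u n + v n)%C (l + m)%C.
Proof.
  intros Hu Hv. apply clim_le with (fun n => Cmod (u n - l)%C + Cmod (v n - m)%C).
  - intros n. eapply Rle_trans; [|apply Cmod_triangle]. apply Req_le. f_equal. ring.
  - replace 0 with (0 + 0) by ring. apply is_lim_seq_plus'; assumption.
Qed.

Lemma clim_scal (c : C) (u : nat -> C) (l : C) :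
  clim u l -> clim (fun n => c * u n)%C (c * l)%C.
Proof.
  intros Hu. apply clim_le with (fun n => Cmod c * Cmod (u n - l)%C).
  - intros n. rewrite <- Cmod_mult. apply Req_le. f_equal. ring.
  - replace 0 with (Cmod c * 0) by ring.
    apply (is_lim_seq_scal_l _ (Cmod c) 0). exact Hu.
Qed.

Lemma is_lim_seq_perturb (c : R) (v : nat -> R) :
  is_lim_seq v 0 ->
  is_lim_seq (fun n => c + v n) c /\ is_lim_seq (fun n => c - v n) c.
Proof.
  intros H. split.
  - replace (Finite c) with (Finite (c + 0)) by (f_equal; ring).
    apply is_lim_seq_plus'; [apply is_lim_seq_const|exact H].
  - replace (Finite c) with (Finite (c - 0)) by (f_equal; ring).
    apply is_lim_seq_minus'; [apply is_lim_seq_const|exact H].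
Qed.

Lemma clim_Cmod (u : nat -> C) (l : C) :
  clim u l -> is_lim_seq (fun n => Cmod (u n)) (Cmod l).
Proof.
  intros H.
  apply is_lim_seq_le_le with (fun n => Cmod l - Cmod (u n - l)%C)
                              (fun n => Cmod l + Cmod (u n - l)%C).
  - intros n. split.
    + assert (Cmod l <= Cmod (u n) + Cmod (l - u n)%C).
      { eapply Rle_trans; [|apply Cmod_triangle]. apply Req_le; f_equal; ring. }
      rewrite (Cmod_sym (u n) l). lra.
    + eapply Rle_trans; [|apply Cmod_triangle]. apply Req_le; f_equal; ring.
  - exact (proj2 (is_lim_seq_perturb _ _ H)).
  - exact (proj1 (is_lim_seq_perturb _ _ H)).
Qed.

Lemma clim_unique (u : nat -> C) (l m : C) : clim u l -> clim u m -> l = m.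
Proof.
  intros Hl Hm.
  assert (H : clim (fun n => u n + (- RtoC 1) * u n)%C (l + (- RtoC 1) * m)%C).
  { apply clim_plus; [assumption|]. now apply clim_scal. }
  apply clim_Cmod in H.
  apply is_lim_seq_ext with (v := fun _ => 0) in H.
  - apply is_lim_seq_unique in H. rewrite Lim_seq_const in H.
    injection H as H. symmetry in H. apply Cmod_eq_0 in H.
    replace l with (m + (l + (- RtoC 1) * m))%C by ring.
    rewrite H. ring.
  - intros n. replace (u n + (- RtoC 1) * u n)%C with (RtoC 0) by ring.
    apply Cmod_0.
Qed.

Lemma clim_Re (u : nat -> C) (l : C) : clim u l -> is_lim_seq (fun n => Re (u n)) (Re l).
Proof.
  intros H.
  apply is_lim_seq_le_le with (fun n => Re l - Cmod (u n - l)%C)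
                              (fun n => Re l + Cmod (u n - l)%C).
  - intros n. generalize (re_le_Cmod (u n - l)%C).
    replace (Re (u n - l)%C) with (Re (u n) - Re l) by reflexivity.
    intros H1. apply Rabs_le_between in H1. lra.
  - exact (proj2 (is_lim_seq_perturb _ _ H)).
  - exact (proj1 (is_lim_seq_perturb _ _ H)).
Qed.

Lemma Cmod_le_Re_Im (z : C) : Cmod z <= Rabs (Re z) + Rabs (Im z).
Proof.
  replace z with (RtoC (Re z) + Ci * RtoC (Im z))%C at 1
    by (destruct z; unfold Ci, RtoC, Cplus, Cmult; simpl; f_equal; ring).
  eapply Rle_trans; [apply Cmod_triangle|].
  rewrite Cmod_mult, Cmod_Ci, !Cmod_R. lra.
Qed.

Lemma clim_of_Re_Im (u : nat -> C) (l : C) :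
  is_lim_seq (fun n => Re (u n)) (Re l) -> is_lim_seq (fun n => Im (u n)) (Im l) -> clim u l.
Proof.
  intros Hr Hi.
  apply clim_le with (fun n => Rabs (Re (u n) - Re l) + Rabs (Im (u n) - Im l)).
  - intros n. apply (Cmod_le_Re_Im (u n - l)%C).
  - replace 0 with (Rabs (Re l - Re l) + Rabs (Im l - Im l))
      by (rewrite !Rminus_diag, Rabs_R0; ring).
    apply is_lim_seq_plus'; apply (is_lim_seq_abs _ (Finite _));
      (apply is_lim_seq_minus'; [assumption|apply is_lim_seq_const]).
Qed.

Lemma clim_incr (u : nat -> C) (l : C) : clim u l <-> clim (fun n => u (S n)) l.
Proof. unfold clim. apply (is_lim_seq_incr_1 (fun n => Cmod (u n - l)%C)). Qed.

Lemma clim_incr_n (u : nat -> C) (N : nat) (l : C) : clim u l <-> clim (fun n => u (n + N)%nat) l.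
Proof. unfold clim. apply (is_lim_seq_incr_n (fun n => Cmod (u n - l)%C)). Qed.

Lemma clim_subseq (u : nat -> C) (phi : nat -> nat) (l : C) :
  filterlim phi eventually eventually -> clim u l -> clim (fun n => u (phi n)) l.
Proof.
  intros Hp Hu. unfold clim in *.
  exact (is_lim_seq_subseq (fun n => Cmod (u n - l)%C) 0 phi Hp Hu).
Qed.

Lemma filterlim_clim (u : nat -> C) (l : C) :
  filterlim u eventually (locally (T := C_UniformSpace) l) <-> clim u l.
Proof.
  rewrite clim_spec.
  split.
  - intros H eps He.
    apply (filterlim_locally_ball_norm (K := C_AbsRing) (U := C_NormedModule)) with
      (eps := mkposreal eps He) in H.
    exact H.
  - intros H.
    apply (filterlim_locally_ball_norm (K := C_AbsRing) (U := C_NormedModule)).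
    intros eps. exact (H eps (cond_pos eps)).
Qed.

Lemma is_series_clim (a : nat -> C) (l : C) :
  is_series (K := C_AbsRing) (V := C_NormedModule) a l <-> clim (csum a) l.
Proof.
  rewrite clim_incr, <- filterlim_clim. unfold is_series.
  split; apply filterlim_ext; intros n; [|symmetry]; apply sum_n_csum.
Qed.

Lemma csum_Re (a : nat -> C) (n : nat) : Re (csum a n) = rsum (fun k => Re (a k)) n.
Proof. induction n as [|n IH]; simpl; [reflexivity|]. now rewrite <- IH. Qed.

Lemma rsum_bounded_cv (A : nat -> R) (S : R) :
  (forall n, 0 <= A n) -> (forall n, rsum A n <= S) ->
  exists l, l <= S /\ is_lim_seq (rsum A) l /\ forall n, rsum A n <= l.
Proof.
  intros H0 HS.
  destruct (ex_finite_lim_seq_incr (rsum A) S) as [l Hl].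
  - intros n. simpl. specialize (H0 n); lra.
  - exact HS.
  - exists l. split; [|split; [exact Hl|]].
    + apply (is_lim_seq_le (rsum A) (fun _ => S) l S HS Hl). apply is_lim_seq_const.
    + apply is_lim_seq_incr_compare; [exact Hl|]. intros n; simpl. specialize (H0 n); lra.
Qed.

Lemma csum_diff_le (a : nat -> C) (A : nat -> R) (n m : nat) :
  (forall k, Cmod (a k) <= A k) -> (n <= m)%nat ->
  Cmod (csum a m - csum a n)%C <= rsum A m - rsum A n.
Proof.
  intros H Hnm. induction Hnm as [|m Hm IH].
  - replace (csum a n - csum a n)%C with (RtoC 0) by ring. rewrite Cmod_0; lra.
  - simpl. replace (csum a m + a m - csum a n)%C with ((csum a m - csum a n) + a m)%C by ring.
    eapply Rle_trans; [apply Cmod_triangle|]. specialize (H m); lra.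
Qed.

Lemma clim_Cmod_le (u : nat -> C) (l c : C) (B : R) (N : nat) :
  clim u l -> (forall n, (N <= n)%nat -> Cmod (u n - c)%C <= B) -> Cmod (l - c)%C <= B.
Proof.
  intros Hu HB. 
  assert (H : clim (fun n => u (n + N)%nat + (- c))%C (l + - c)%C).
  { apply clim_plus; [now apply (clim_incr_n u N)|apply clim_const]. }
  apply clim_Cmod in H.
  apply (is_lim_seq_le (fun n => Cmod (u (n + N)%nat + - c)%C) (fun _ => B) 
           (Cmod (l + - c)%C) B); [|exact H|apply is_lim_seq_const].
  intros n. apply HB. lia.
Qed.

Lemma csum_abs_cv (a : nat -> C) (A : nat -> R) (S : R) :
  (forall k, Cmod (a k) <= A k) -> (forall n, rsum A n <= S) ->
  exists l, clim (csum a) l.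
Proof.
  intros H HS.
  assert (HA : forall n, 0 <= A n) by (intros n; eapply Rle_trans; [apply Cmod_ge_0|apply H]).
  assert (ex_series (K := C_AbsRing) (V := C_CompleteNormedModule) a) as [l Hl].
  { apply (ex_series_le (K := C_AbsRing) (V := C_CompleteNormedModule)) with A.
    - intros n. exact (H n).
    - destruct (rsum_bounded_cv A S HA HS) as [l [_ [Hl _]]]. exists l.
      apply (is_lim_seq_incr_1 (rsum A)) in Hl.
      apply is_lim_seq_ext with (2 := Hl). intros n.
      induction n as [|n IH]; [rewrite sum_O; simpl; ring|].
      rewrite sum_Sn, <- IH. reflexivity. }
  exists l. apply is_series_clim, Hl.
Qed.

(** * Absolutely convergent power series on a disc *)

(* The Banach algebra norm [sum |a_k| r^k] is submultiplicative and countably subadditive, so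
   closing [wiener] under products and infinite sums yields analyticity without Cauchy theory. *)
Definition wiener (r : R) (f : C -> C) (A : R) : Prop :=
  exists a : nat -> C,
    (forall w, Cmod w <= r -> clim (csum (fun k => a k * w ^ k)%C) (f w)) /\
    (forall K, rsum (fun k => Cmod (a k) * r ^ k) K <= A).

Lemma wiener_nonneg (r : R) (f : C -> C) (A : R) : wiener r f A -> 0 <= A.
Proof. intros [a [_ H]]. exact (H O). Qed.

Lemma wiener_ext (r : R) (f g : C -> C) (A B : R) :
  (forall w, Cmod w <= r -> f w = g w) -> A <= B -> wiener r f A -> wiener r g B.
Proof.
  intros Hfg HAB [a [H1 H2]]. exists a. split.
  - intros w Hw. rewrite <- Hfg by assumption. now apply H1.
  - intros K. eapply Rle_trans; [apply H2|exact HAB].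
Qed.

Lemma wiener_term (a : nat -> C) (w : C) (r : R) (k : nat) :
  Cmod w <= r -> Cmod (a k * w ^ k)%C <= Cmod (a k) * r ^ k.
Proof.
  intros Hw. rewrite Cmod_mult, Cmod_pow.
  apply Rmult_le_compat_l; [apply Cmod_ge_0|].
  apply pow_incr. split; [apply Cmod_ge_0|exact Hw].
Qed.

Lemma wiener_bound (r : R) (f : C -> C) (A : R) (w : C) :
  wiener r f A -> Cmod w <= r -> Cmod (f w) <= A.
Proof.
  intros [a [H1 H2]] Hw.
  replace (f w) with (f w - RtoC 0)%C by ring.
  apply clim_Cmod_le with (csum (fun k => a k * w ^ k)%C) O; [now apply H1|].
  intros n _. eapply Rle_trans; [|apply (H2 n)].
  replace (csum (fun k => a k * w ^ k) n - RtoC 0)%C with (csum (fun k => a k * w ^ k)%C n) by ring.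
  eapply Rle_trans; [apply Cmod_csum|]. apply rsum_le. intros k _. now apply wiener_term.
Qed.

Lemma wiener_scal (r : R) (f : C -> C) (A : R) (c : C) :
  wiener r f A -> wiener r (fun w => c * f w)%C (Cmod c * A).
Proof.
  intros [a [H1 H2]]. exists (fun k => c * a k)%C. split.
  - intros w Hw. apply clim_ext with (fun n => c * csum (fun k => a k * w ^ k) n)%C.
    + intros n. rewrite <- csum_scal. apply csum_ext. intros; ring.
    + now apply clim_scal, H1.
  - intros K.
    rewrite rsum_ext with (g := fun k => Cmod c * (Cmod (a k) * r ^ k))
      by (intros; rewrite Cmod_mult; ring).
    rewrite rsum_scal. apply Rmult_le_compat_l; [apply Cmod_ge_0|apply H2].
Qed.

Lemma wiener_plus (r : R) (f g : C -> C) (A B : R) :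
  0 <= r -> wiener r f A -> wiener r g B -> wiener r (fun w => f w + g w)%C (A + B).
Proof.
  intros Hr [a [H1 H2]] [b [H3 H4]]. exists (fun k => a k + b k)%C. split.
  - intros w Hw. eapply clim_ext; [|apply clim_plus; [apply (H1 w Hw)|apply (H3 w Hw)]].
    intros n. simpl. rewrite <- csum_plus. apply csum_ext. intros; ring.
  - intros K. eapply Rle_trans; [|apply Rplus_le_compat; [apply (H2 K)|apply (H4 K)]].
    rewrite <- rsum_plus. apply rsum_le. intros k _.
    rewrite <- Rmult_plus_distr_r. apply Rmult_le_compat_r; [now apply pow_le|].
    apply Cmod_triangle.
Qed.

Lemma wiener_const (r : R) (c : C) : wiener r (fun _ => c) (Cmod c).
Proof.
  exists (fun k => match k with O => c | _ => RtoC 0 end). split.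
  - intros w _. apply clim_incr. eapply clim_ext; [|apply clim_const].
    intros n. rewrite csum_shift.
    rewrite csum_scal. simpl. ring.
  - intros [|K]; [apply Cmod_ge_0|]. rewrite rsum_shift.
    rewrite rsum_ext with (g := fun _ => 0 * 0) by (intros; rewrite Cmod_0; ring).
    rewrite rsum_scal. simpl. lra.
Qed.

Lemma wiener_shift (r : R) (f : C -> C) (A : R) :
  0 <= r -> wiener r f A -> wiener r (fun w => w * f w)%C (r * A).
Proof.
  intros Hr [a [H1 H2]]. exists (fun k => match k with O => RtoC 0 | S k => a k end). split.
  - intros w Hw. apply clim_incr.
    apply clim_ext with (fun n => w * csum (fun k => a k * w ^ k) n)%C.
    + intros n. rewrite csum_shift, <- csum_scal. rewrite Cmult_0_l, Cplus_0_l.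
      apply csum_ext. intros k _. rewrite Cpow_S. ring.
    + now apply clim_scal, H1.
  - intros [|K].
    + simpl. apply Rmult_le_pos; [exact Hr|exact (H2 O)].
    + rewrite rsum_shift, Cmod_0.
      rewrite rsum_ext with (g := fun k => r * (Cmod (a k) * r ^ k)) by (intros; simpl; ring).
      rewrite rsum_scal. assert (H := Rmult_le_compat_l r _ _ Hr (H2 K)). lra.
Qed.

Lemma rsum_diff_le (f g : nat -> R) (n m : nat) :
  (forall k, f k <= g k) -> (n <= m)%nat -> rsum f m - rsum f n <= rsum g m - rsum g n.
Proof.
  intros H Hnm. induction Hnm as [|m Hm IH]; [lra|]. simpl. specialize (H m); lra.
Qed.

Lemma is_lim_seq_rsum (u : nat -> nat -> R) (l : nat -> R) (K : nat) :
  (forall k, is_lim_seq (u k) (l k)) ->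
  is_lim_seq (fun M => rsum (fun k => u k M) K) (rsum l K).
Proof.
  intros H. induction K as [|K IH]; simpl; [apply is_lim_seq_const|].
  apply is_lim_seq_plus'; auto.
Qed.

Lemma clim_csum (u : nat -> nat -> C) (l : nat -> C) (N : nat) :
  (forall k, clim (u k) (l k)) -> clim (fun M => csum (fun k => u k M) N) (csum l N).
Proof.
  intros H. induction N as [|K IH]; simpl; [apply clim_const|]. apply clim_plus; auto.
Qed.

Lemma csum_mult_r (f : nat -> C) (n : nat) (c : C) :
  csum (fun k => f k * c)%C n = (csum f n * c)%C.
Proof. induction n as [|n IH]; simpl; [ring|rewrite IH; ring]. Qed.

Lemma csum_swap (f : nat -> nat -> C) (n m : nat) :
  csum (fun i => csum (f i) m) n = csum (fun j => csum (fun i => f i j) n) m.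
Proof.
  induction n as [|n IH]; simpl.
  - induction m as [|m IHm]; simpl; [reflexivity|rewrite <- IHm; ring].
  - rewrite IH. rewrite <- csum_plus. apply csum_ext; reflexivity.
Qed.

(** Completeness of the algebra: the k-th coefficient of the sum is the sum over n of the k-th
    coefficients, which converges because each is at most [A n / r ^ k]. *)
Lemma wiener_sum (r : R) (fs : nat -> C -> C) (A : nat -> R) (S : R) (f : C -> C) :
  0 < r -> (forall n, wiener r (fs n) (A n)) -> (forall N, rsum A N <= S) ->
  (forall w, Cmod w <= r -> clim (csum (fun n => fs n w)) (f w)) ->
  wiener r f S.
Proof.
  intros Hr Hfs HS Hf.
  assert (HA : forall n, 0 <= A n) by (intros n; exact (wiener_nonneg _ _ _ (Hfs n))).
  set (a := fun n => proj1_sig (constructive_indefinite_description _ (Hfs n))).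
  assert (Ha : forall n,
    (forall w, Cmod w <= r -> clim (csum (fun k => a n k * w ^ k)%C) (fs n w)) /\
    (forall K, rsum (fun k => Cmod (a n k) * r ^ k) K <= A n)).
  { intros n. exact (proj2_sig (constructive_indefinite_description _ (Hfs n))). }
  clearbody a.
  assert (Hrk : forall k, 0 < r ^ k) by (intros; now apply pow_lt).
  assert (Hak : forall n k, Cmod (a n k) * r ^ k <= A n).
  { intros n k. eapply Rle_trans; [|apply (proj2 (Ha n) (Datatypes.S k))].
    simpl. assert (0 <= rsum (fun k => Cmod (a n k) * r ^ k) k).
    { apply rsum_nonneg. intros j. apply Rmult_le_pos; [apply Cmod_ge_0|apply Rlt_le, Hrk]. }
    lra. }
  destruct (rsum_bounded_cv A S HA HS) as [L [HLS [HL HAL]]].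
  assert (Hb : forall k, exists b, clim (csum (fun n => a n k)) b).
  { intros k. apply csum_abs_cv with (fun n => / r ^ k * A n) (/ r ^ k * S).
    - intros n. apply Rmult_le_reg_r with (r ^ k); [apply Hrk|].
      replace (/ r ^ k * A n * r ^ k) with (A n); [apply Hak|].
      field. apply Rgt_not_eq, Hrk.
    - intros n. rewrite rsum_scal. apply Rmult_le_compat_l; [|apply HS].
      apply Rlt_le, Rinv_0_lt_compat, Hrk. }
  set (b := fun k => proj1_sig (constructive_indefinite_description _ (Hb k))).
  assert (Hbk : forall k, clim (csum (fun n => a n k)) (b k)).
  { intros k. exact (proj2_sig (constructive_indefinite_description _ (Hb k))). }
  clearbody b.
  (* The weighted distance from [b] to the coefficients of the N-th partial sum is at most the tail
     of [A]: interchange the finite sums for a block of M further functions, then let M grow. *)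
  assert (key : forall K N,
    rsum (fun k => Cmod (b k - csum (fun n => a n k) N)%C * r ^ k) K <= L - rsum A N).
  { intros K N.
    apply (is_lim_seq_le
      (fun M => rsum (fun k => Cmod (csum (fun n => a n k) (M + N) - csum (fun n => a n k) N)%C * r ^ k) K)
      (fun _ => L - rsum A N)
      (rsum (fun k => Cmod (b k - csum (fun n => a n k) N)%C * r ^ k) K) (L - rsum A N)).
    - intros M.
      apply Rle_trans with (rsum A (M + N) - rsum A N); [|specialize (HAL (M + N)%nat); lra].
      eapply Rle_trans; [|apply (rsum_diff_le (fun n => rsum (fun k => Cmod (a n k) * r ^ k) K) A);
        [intros n; apply Ha|lia]].
      rewrite (rsum_swap (fun n k => Cmod (a n k) * r ^ k) (M + N) K), (rsum_swap (fun n k => Cmod (a n k) * r ^ k) N K).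
      apply Rle_trans with (rsum (fun k => rsum (fun n => Cmod (a n k) * r ^ k) (M + N) -
        rsum (fun n => Cmod (a n k) * r ^ k) N) K).
      + apply rsum_le. intros k _.
        assert (Hc : forall m, rsum (fun n => Cmod (a n k) * r ^ k) m
                               = rsum (fun n => Cmod (a n k)) m * r ^ k).
        { intros m. rewrite rsum_ext with (g := fun n => r ^ k * Cmod (a n k)) by (intros; ring).
          rewrite rsum_scal. ring. }
        rewrite !Hc, <- Rmult_minus_distr_r.
        apply Rmult_le_compat_r; [apply Rlt_le, Hrk|].
        apply csum_diff_le; [intros; lra|lia].
      + right. clear. induction K as [|K IH]; simpl; [ring|rewrite IH; ring].
    - apply (is_lim_seq_rsum
        (fun k M => Cmod (csum (fun n => a n k) (M + N) - csum (fun n => a n k) N)%C * r ^ k)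
        (fun k => Cmod (b k - csum (fun n => a n k) N)%C * r ^ k)).
      intros k.
      apply (is_lim_seq_scal_r _ (r ^ k) (Cmod (b k - csum (fun n => a n k) N)%C)).
      apply clim_Cmod.
      apply (clim_plus (fun M => csum (fun n => a n k) (M + N)%nat) (fun _ => (- csum (fun n => a n k) N)%C)).
      + now apply (clim_incr_n (csum (fun n => a n k)) N).
      + apply clim_const.
    - apply is_lim_seq_const. }
  exists b. split.
  (* Three errors: [b] against the coefficients of the first N functions, the power series of these
     N functions at w, and the tail of the sum defining f. N is fixed before K grows. *)
  - intros w Hw. apply clim_spec. intros eps He.
    assert (exists N, L - rsum A N < eps / 4) as [N HN].
    { apply is_lim_seq_spec in HL. destruct (HL (mkposreal (eps / 4) ltac:(lra))) as [N HN].
      exists N. specialize (HN N ltac:(lia)). simpl in HN. apply Rabs_lt_between in HN. lra. }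
    assert (Hmid : clim (fun K => csum (fun k => csum (fun n => a n k) N * w ^ k)%C K)
                        (csum (fun n => fs n w) N)).
    { apply clim_ext with (fun K => csum (fun n => csum (fun k => a n k * w ^ k)%C K) N).
      - intros K. rewrite csum_swap. apply csum_ext. intros k _. now rewrite csum_mult_r.
      - apply (clim_csum (fun n K => csum (fun k => a n k * w ^ k)%C K)). intros n. now apply Ha. }
    apply clim_spec with (eps := eps / 4) in Hmid; [|lra].
    destruct Hmid as [K0 HK0]. exists K0. intros K HK. specialize (HK0 K HK).
    assert (Htail : Cmod (f w - csum (fun n => fs n w) N)%C <= L - rsum A N).
    { apply clim_Cmod_le with (csum (fun n => fs n w)) N; [now apply Hf|].
      intros n Hn. apply Rle_trans with (rsum A n - rsum A N); [|specialize (HAL n); lra].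
      apply csum_diff_le; [|exact Hn]. intros k. now apply wiener_bound with r. }
    rewrite Cmod_sym in Htail.
    assert (Hhead : Cmod (csum (fun k => (b k - csum (fun n => a n k) N) * w ^ k)%C K)
                    <= L - rsum A N).
    { eapply Rle_trans; [apply Cmod_csum|]. eapply Rle_trans; [|apply (key K N)].
      apply rsum_le. intros k _.
      now apply (wiener_term (fun k => b k - csum (fun n => a n k) N)%C). }
    replace (csum (fun k => b k * w ^ k) K - f w)%C with
      (csum (fun k => (b k - csum (fun n => a n k) N) * w ^ k) K +
       ((csum (fun k => csum (fun n => a n k) N * w ^ k) K - csum (fun n => fs n w) N) +
        (csum (fun n => fs n w) N - f w)))%C.
    + eapply Rle_lt_trans; [apply Cmod_triangle|].
      eapply Rle_lt_trans; [apply Rplus_le_compat_l, Cmod_triangle|]. lra.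
    + rewrite csum_ext with (f := fun k => ((b k - csum (fun n => a n k) N) * w ^ k)%C)
        (g := fun k => (b k * w ^ k + (- RtoC 1) * (csum (fun n => a n k) N * w ^ k))%C)
        by (intros; ring).
      rewrite csum_plus, csum_scal. ring.
  - intros K. eapply Rle_trans; [|exact HLS]. specialize (key K O). simpl in key.
    rewrite Rminus_0_r in key. eapply Rle_trans; [|exact key].
    apply rsum_le. intros k _. right. do 2 f_equal. ring.
Qed.

(** Instead of a Cauchy product, f g is the infinite sum of the functions a_k w^k g; multiplication
    by w is a shift of coefficients and costs a factor r. *)
Lemma wiener_mult (r : R) (f g : C -> C) (A B : R) :
  0 < r -> wiener r f A -> wiener r g B -> wiener r (fun w => f w * g w)%C (A * B).
Proof.
  intros Hr [a [H1 H2]] Hg.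
  assert (HB := wiener_nonneg _ _ _ Hg).
  apply wiener_sum with (fun k w => a k * (w ^ k * g w))%C (fun k => B * (Cmod (a k) * r ^ k));
    [exact Hr| | |].
  - intros k. apply wiener_ext with (fun w => a k * (w ^ k * g w))%C (Cmod (a k) * (r ^ k * B));
      [reflexivity|right; ring|].
    apply wiener_scal. induction k as [|k IH].
    + apply wiener_ext with g B; [intros; simpl; ring|simpl; lra|exact Hg].
    + apply wiener_ext with (fun w => w * (w ^ k * g w))%C (r * (r ^ k * B)).
      * intros; rewrite Cpow_S; ring.
      * simpl; right; ring.
      * apply wiener_shift; [lra|exact IH].
  - intros N. rewrite rsum_scal, Rmult_comm. now apply Rmult_le_compat_r.
  - intros w Hw. apply clim_ext with (fun n => g w * csum (fun k => a k * w ^ k) n)%C.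
    + intros n. rewrite <- csum_scal. apply csum_ext. intros; ring.
    + rewrite (Cmult_comm (f w)). now apply clim_scal, H1.
Qed.

Lemma wiener_pow (r : R) (f : C -> C) (A : R) (n : nat) :
  0 < r -> wiener r f A -> wiener r (fun w => f w ^ n)%C (A ^ n).
Proof.
  intros Hr Hf. induction n as [|n IH].
  - apply wiener_ext with (fun _ => RtoC 1) (Cmod 1);
      [reflexivity|rewrite Cmod_1; simpl; lra|apply wiener_const].
  - apply wiener_ext with (fun w => f w * f w ^ n)%C (A * A ^ n);
      [intros; now rewrite Cpow_S|simpl; lra|]. now apply wiener_mult.
Qed.

Lemma wiener_id (r : R) : 0 <= r -> wiener r (fun w => w) r.
Proof.
  intros Hr. apply wiener_ext with (fun w => w * RtoC 1)%C (r * Cmod 1);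
    [intros; ring|rewrite Cmod_1; lra|].
  apply wiener_shift; [exact Hr|apply wiener_const].
Qed.

Lemma pow_n_Cpow (z : C) (n : nat) : pow_n (K := C_Ring) z n = (z ^ n)%C.
Proof. induction n as [|n IH]; [reflexivity|]. rewrite Cpow_S, <- IH. reflexivity. Qed.

Lemma wiener_analytic (r : R) (f : C -> C) (A : R) (s : C) :
  0 < r -> wiener r (fun w => f (s + w)%C) A -> analytic_at f s.
Proof.
  intros Hr [a [H _]]. exists a.
  (* Balls of [C_UniformSpace] are squares; half the radius in each coordinate keeps the modulus
     below r. *)
  exists (mkposreal (r / 2) ltac:(lra)). intros z [Hz1 Hz2].
  apply is_series_clim.
  apply clim_ext with (csum (fun k => a k * (z - s) ^ k)%C).
  - intros n. apply csum_ext. intros k _. rewrite Cmult_comm, <- pow_n_Cpow. reflexivity.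
  - replace (f z) with (f (s + (z - s))%C) by (f_equal; ring). apply H.
    eapply Rle_trans; [apply Cmod_le_Re_Im|].
    unfold ball in Hz1, Hz2; simpl in Hz1, Hz2. unfold AbsRing_ball, abs, minus, plus, opp in Hz1, Hz2.
    simpl in *. unfold Re, Im. simpl. unfold Rminus. lra.
Qed.

(** * The complex exponential *)

Lemma Cexp_plus (z w : C) : Cexp (z + w)%C = (Cexp z * Cexp w)%C.
Proof.
  destruct z as [a b], w as [c d]. unfold Cexp, Cplus, Cmult, Re, Im; simpl.
  rewrite exp_plus, cos_plus, sin_plus. f_equal; ring.
Qed.

Lemma Cexp_0 : Cexp (RtoC 0) = RtoC 1.
Proof. unfold Cexp, RtoC, Re, Im; simpl. rewrite exp_0, cos_0, sin_0. f_equal; ring. Qed.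

Lemma Cexp_RtoC (x : R) : Cexp (RtoC x) = RtoC (exp x).
Proof. unfold Cexp, RtoC, Re, Im; simpl. rewrite cos_0, sin_0. f_equal; ring. Qed.

Lemma Cmod_Cexp (z : C) : Cmod (Cexp z) = exp (Re z).
Proof.
  unfold Cexp, Cmod; simpl.
  replace (_ + _) with (exp (Re z) * exp (Re z)).
  - apply sqrt_square, Rlt_le, exp_pos.
  - transitivity (exp (Re z) * exp (Re z) * (Rsqr (sin (Im z)) + Rsqr (cos (Im z)))).
    + rewrite sin2_cos2; ring.
    + unfold Rsqr; ring.
Qed.

Lemma is_derive_Re_Cexp (c z : C) (t : R) :
  is_derive (fun t => Re (c * Cexp (RtoC t * z))%C) t (Re (c * z * Cexp (RtoC t * z))%C).
Proof.
  destruct c as [c d], z as [x y]. unfold Cexp, Cmult, RtoC, Re, Im; simpl.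
  auto_derive; [trivial|]. unfold Rminus. ring.
Qed.

Lemma Derive_n_Re_Cexp (z : C) (n : nat) :
  forall c t,
  (forall k, (k <= n)%nat -> ex_derive_n (fun t => Re (c * Cexp (RtoC t * z))%C) k t) /\
  Derive_n (fun t => Re (c * Cexp (RtoC t * z))%C) n t = Re (c * z ^ n * Cexp (RtoC t * z))%C.
Proof.
  intros c. induction n as [|n IH]; intros t.
  - split.
    + intros k Hk. replace k with O by lia. exact I.
    + replace (c * z ^ 0)%C with c by (change (z ^ 0)%C with (RtoC 1); ring). reflexivity.
  - assert (He : forall t, is_derive (Derive_n (fun t => Re (c * Cexp (RtoC t * z))%C) n) t
              (Re (c * z ^ S n * Cexp (RtoC t * z))%C)).
    { intros t'. apply is_derive_ext with (fun t => Re (c * z ^ n * Cexp (RtoC t * z))%C).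
      - intros t0. symmetry. apply IH.
      - replace (c * z ^ S n)%C with (c * z ^ n * z)%C by (rewrite Cpow_S; ring).
        apply is_derive_Re_Cexp. }
    split.
    + intros k Hk. destruct (Nat.eq_dec k (S n)) as [->|Hne]; [|apply (proj1 (IH t)); lia].
      simpl. eexists. apply He.
    + simpl. now apply is_derive_unique.
Qed.

Lemma Re_RtoC_mult (x : R) (z : C) : Re (RtoC x * z)%C = x * Re z.
Proof. destruct z. unfold Re, RtoC, Cmult; simpl. ring. Qed.

(** Taylor's formula with Lagrange remainder on [0, 1] for the real function t -> Re (c e^(tz)); the
    remainder is at most |c| e^|z| |z|^(n+1) / (n+1)!. The values c = 1 and c = -i recover both
    parts of [Cexp z]. *)
Lemma Re_Cexp_series (c z : C) :
  is_lim_seq (fun n => Re (c * csum (fun k => RtoC (/ INR (fact k)) * z ^ k) n)%C)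
             (Re (c * Cexp z)%C).
Proof.
  apply is_lim_seq_incr_1.
  set (B := Cmod c * exp (Cmod z)).
  assert (Hz : is_lim_seq (fun n => B * (Cmod z ^ S n / INR (fact (S n)))) 0).
  { replace (Finite 0) with (Finite (B * 0)) by (f_equal; ring).
    apply (is_lim_seq_scal_l _ B 0).
    apply (is_lim_seq_incr_1 (fun n => Cmod z ^ n / INR (fact n))).
    apply is_lim_seq_Reals. apply cv_speed_pow_fact. }
  destruct (is_lim_seq_perturb (Re (c * Cexp z)%C) _ Hz) as [H1 H2].
  apply is_lim_seq_le_le with (2 := H2) (3 := H1).
  intros n.
  destruct (Taylor_Lagrange (fun t => Re (c * Cexp (RtoC t * z))%C) n 0 1 ltac:(lra))
    as [x [Hx E]].
  { intros t _ k Hk. apply (proj1 (Derive_n_Re_Cexp z (S n) c t)); lia. }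
  rewrite (proj2 (Derive_n_Re_Cexp z (S n) c x)) in E.
  replace (RtoC 1 * z)%C with z in E by ring.
  rewrite E.
  replace (sum_f_R0 _ n) with
    (Re (c * csum (fun k => RtoC (/ INR (fact k)) * z ^ k) (S n))%C).
  2:{ clear. rewrite <- csum_scal, csum_Re.
      assert (Ht : forall k, Re (c * (RtoC (/ INR (fact k)) * z ^ k))%C =
        (1 - 0) ^ k / INR (fact k) * Derive_n (fun t => Re (c * Cexp (RtoC t * z))%C) k 0).
      { intros k. rewrite (proj2 (Derive_n_Re_Cexp z k c 0)).
        replace (RtoC 0 * z)%C with (RtoC 0) by ring. rewrite Cexp_0, Rminus_0_r, pow1.
        replace (c * (RtoC (/ INR (fact k)) * z ^ k))%C with
          (RtoC (/ INR (fact k)) * (c * z ^ k * RtoC 1))%C by ring.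
        rewrite Re_RtoC_mult. unfold Rdiv. ring. }
      induction n as [|n IH].
      - change (0 + Re (c * (RtoC (/ INR (fact 0)) * z ^ 0))%C =
          (1 - 0) ^ 0 / INR (fact 0) * Derive_n (fun t => Re (c * Cexp (RtoC t * z))%C) 0 0).
        rewrite Ht. ring.
      - change (sum_f_R0 ?f (S n)) with (sum_f_R0 f n + f (S n)). rewrite <- IH.
        change (rsum ?f (S (S n))) with (rsum f (S n) + f (S n)).
        f_equal. apply Ht. }
  assert (Hr : Rabs ((1 - 0) ^ S n / INR (fact (S n)) * Re (c * z ^ S n * Cexp (RtoC x * z))%C)
               <= B * (Cmod z ^ S n / INR (fact (S n)))).
  { rewrite Rminus_0_r, pow1, Rabs_mult.
    rewrite (Rabs_pos_eq (1 / _)) by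
      (apply Rmult_le_pos; [lra|apply Rlt_le, Rinv_0_lt_compat, INR_fact_lt_0]).
    replace (B * (Cmod z ^ S n / INR (fact (S n)))) with
      (1 / INR (fact (S n)) * (Cmod c * Cmod z ^ S n * exp (Cmod z)))
      by (unfold B; field; apply INR_fact_neq_0).
    apply Rmult_le_compat_l.
    - apply Rmult_le_pos; [lra|apply Rlt_le, Rinv_0_lt_compat, INR_fact_lt_0].
    - eapply Rle_trans; [apply re_le_Cmod|]. rewrite !Cmod_mult, Cmod_pow, Cmod_Cexp.
      apply Rmult_le_compat_l.
      + apply Rmult_le_pos; [apply Cmod_ge_0|apply pow_le, Cmod_ge_0].
      + rewrite Re_RtoC_mult. 
        assert (Hle : x * Re z <= Cmod z).
        { assert (H := re_le_Cmod z). apply Rabs_le_between in H.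
          assert (0 <= Cmod z) by apply Cmod_ge_0. nra. }
        destruct Hle as [Hle|Hle]; [apply Rlt_le, exp_increasing, Hle|rewrite Hle; lra]. }
  apply Rabs_le_between in Hr. lra.
Qed.

Lemma Cexp_series (z : C) :
  clim (csum (fun k => RtoC (/ INR (fact k)) * z ^ k)%C) (Cexp z).
Proof.
  apply clim_of_Re_Im.
  - generalize (Re_Cexp_series (RtoC 1) z). rewrite Cmult_1_l.
    apply is_lim_seq_ext. intros n. now rewrite Cmult_1_l.
  - assert (Him : forall w : C, Re ((- Ci) * w)%C = Im w).
    { intros [a b]. unfold Ci, Re, Im, Copp, Cmult; simpl. ring. }
    generalize (Re_Cexp_series (- Ci)%C z). rewrite Him.
    apply is_lim_seq_ext. intros n. apply Him.
Qed.

Lemma rsum_exp_le (x : R) (N : nat) : 0 <= x -> rsum (fun k => / INR (fact k) * x ^ k) N <= exp x.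
Proof.
  intros Hx.
  assert (H := clim_Re _ _ (Cexp_series (RtoC x))). rewrite Cexp_RtoC in H.
  apply (is_lim_seq_incr_compare (rsum (fun k => / INR (fact k) * x ^ k))).
  - revert H. apply is_lim_seq_ext. intros n. rewrite csum_Re. apply rsum_ext. intros k _.
    rewrite Re_RtoC_mult, <- RtoC_pow. reflexivity.
  - intros n. simpl.
    assert (0 <= / INR (fact n) * x ^ n).
    { apply Rmult_le_pos; [apply Rlt_le, Rinv_0_lt_compat, INR_fact_lt_0|now apply pow_le]. }
    lra.
Qed.

Lemma Cmod_inv_fact (k : nat) : Cmod (RtoC (/ INR (fact k))) = / INR (fact k).
Proof. rewrite Cmod_R. apply Rabs_pos_eq, Rlt_le, Rinv_0_lt_compat, INR_fact_lt_0. Qed.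

Lemma wiener_exp (r : R) (f : C -> C) (A : R) :
  0 < r -> wiener r f A -> wiener r (fun w => Cexp (f w)) (exp A).
Proof.
  intros Hr Hf.
  apply wiener_sum with (fun k w => RtoC (/ INR (fact k)) * f w ^ k)%C
                        (fun k => / INR (fact k) * A ^ k); [exact Hr| | |].
  - intros k. eapply wiener_ext; [reflexivity| |now apply wiener_scal, wiener_pow, Hf].
    rewrite Cmod_inv_fact. lra.
  - intros N. apply rsum_exp_le. exact (wiener_nonneg _ _ _ Hf).
  - intros w _. apply Cexp_series.
Qed.

(** For d <= 1 every power d^(2+k) is at most d^2. This factor d^2, with d about 1/n, is the source
    of the convergence of [zeta_term] beyond Re z > 1. *)
Lemma wiener_exp_remainder (r d : R) (f : C -> C) (A : R) :
  0 < r -> 0 <= d <= 1 -> wiener r f A ->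
  wiener r (fun w => Cexp (RtoC d * f w) - RtoC 1 - RtoC d * f w)%C (d ^ 2 * exp A).
Proof.
  intros Hr Hd Hf. assert (HA := wiener_nonneg _ _ _ Hf).
  apply wiener_sum with (fun k w => RtoC (/ INR (fact (2 + k))) * (RtoC d * f w) ^ (2 + k))%C
                        (fun k => d ^ 2 * (/ INR (fact (2 + k)) * A ^ (2 + k))); [exact Hr| | |].
  - intros k.
    apply wiener_ext with (fun w => RtoC (/ INR (fact (2 + k))) * (RtoC d * f w) ^ (2 + k))%C
      (/ INR (fact (2 + k)) * (d * A) ^ (2 + k)); [reflexivity| |].
    + rewrite Rpow_mult_distr.
      replace (d ^ 2 * (/ INR (fact (2 + k)) * A ^ (2 + k))) with
        (/ INR (fact (2 + k)) * (d ^ 2 * A ^ (2 + k))) by ring.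
      apply Rmult_le_compat_l; [apply Rlt_le, Rinv_0_lt_compat, INR_fact_lt_0|].
      apply Rmult_le_compat_r; [now apply pow_le|].
      rewrite pow_add. rewrite <- (Rmult_1_r (d ^ 2)) at 2.
      apply Rmult_le_compat_l; [apply pow_le; lra|].
      rewrite <- (pow1 k). apply pow_incr; lra.
    + apply wiener_ext with (fun w => RtoC (/ INR (fact (2 + k))) * (RtoC d * f w) ^ (2 + k))%C
        (Cmod (RtoC (/ INR (fact (2 + k)))) * (d * A) ^ (2 + k));
        [reflexivity|rewrite Cmod_inv_fact; lra|].
      apply wiener_scal, wiener_pow; [exact Hr|].
      apply wiener_ext with (fun w => RtoC d * f w)%C (Cmod (RtoC d) * A); [reflexivity| |].
      * rewrite Cmod_R, Rabs_pos_eq; lra.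
      * now apply wiener_scal.
  - intros N. rewrite rsum_scal. apply Rmult_le_compat_l; [apply pow_le; lra|].
    eapply Rle_trans; [|apply (rsum_exp_le A (2 + N) HA)].
    change (2 + N)%nat with (S (S N)). rewrite 2!rsum_shift.
    set (X := rsum (fun k => / INR (fact (2 + k)) * A ^ (2 + k)) N).
    change (X <= / 1 * A ^ 0 + (/ 1 * A ^ 1 + X)).
    rewrite Rinv_1. simpl pow. lra.
  - intros w _. set (z := (RtoC d * f w)%C).
    assert (H := Cexp_series z).
    apply (clim_incr_n _ 2) in H.
    assert (H' := clim_plus _ _ _ _ H (clim_const (- RtoC 1 - z)%C)).
    replace (Cexp z - RtoC 1 - z)%C with (Cexp z + (- RtoC 1 - z))%C by ring.
    revert H'. apply clim_ext. intros n.
    replace (n + 2)%nat with (S (S n)) by lia. rewrite 2!csum_shift.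
    set (X := csum (fun k => (RtoC (/ INR (fact (S (S k)))) * z ^ S (S k))%C) n).
    change ((RtoC (/ 1) * RtoC 1 + (RtoC (/ 1) * (z * RtoC 1) + X) + (- RtoC 1 - z))%C = X).
    rewrite Rinv_1. ring.
Qed.

(** * Continuation of zeta to Re s > 0 *)

(* Indices are shifted: [npow n z] is (n+1)^z, and [lnS n] is ln (n+1). *)
Definition npow (n : nat) (z : C) : C := Rpow_C (INR (S n)) z.

Definition lnS (n : nat) : R := ln (INR (S n)).

Lemma INR_S_pos (n : nat) : 0 < INR (S n).
Proof. apply lt_0_INR; lia. Qed.

Lemma exp_lnS (n : nat) : exp (lnS n) = INR (S n).
Proof. apply exp_ln, INR_S_pos. Qed.

Lemma lnS_nonneg (n : nat) : 0 <= lnS n.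
Proof.
  unfold lnS. rewrite <- ln_1. apply ln_le; [lra|]. rewrite S_INR. generalize (pos_INR n); lra.
Qed.

Lemma lnS_0 : lnS 0 = 0.
Proof. unfold lnS. simpl. apply ln_1. Qed.

Lemma npow_plus (n : nat) (z w : C) : npow n (z + w)%C = (npow n z * npow n w)%C.
Proof. unfold npow, Rpow_C. rewrite <- Cexp_plus. f_equal. ring. Qed.

Lemma Cmod_npow (n : nat) (z : C) : Cmod (npow n z) = exp (Re z * lnS n).
Proof.
  unfold npow, Rpow_C. rewrite Cmod_Cexp. f_equal.
  rewrite Cmult_comm, Re_RtoC_mult. unfold lnS; ring.
Qed.

Lemma npow_0 (z : C) : npow 0 z = RtoC 1.
Proof.
  unfold npow, Rpow_C. change (INR 1) with 1. rewrite ln_1.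
  replace (z * RtoC 0)%C with (RtoC 0) by ring. apply Cexp_0.
Qed.

Lemma npow_1 (n : nat) : npow n (RtoC 1) = RtoC (INR (S n)).
Proof.
  unfold npow, Rpow_C. rewrite Cmult_1_l, Cexp_RtoC. f_equal. apply exp_lnS.
Qed.

Lemma exp_le_compat (x y : R) : x <= y -> exp x <= exp y.
Proof. intros [H| ->]; [apply Rlt_le, exp_increasing, H|lra]. Qed.

Lemma ln_le_sub_1 (y : R) : 0 < y -> ln y <= y - 1.
Proof.
  intros Hy. assert (H := exp_ineq1_le (ln y)). rewrite exp_ln in H by assumption. lra.
Qed.

Lemma lnS_diff_le (n : nat) : lnS (S n) - lnS n <= / INR (S n).
Proof.
  assert (H := INR_S_pos n). unfold lnS. rewrite <- ln_div by apply INR_S_pos.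
  eapply Rle_trans; [apply ln_le_sub_1, Rdiv_lt_0_compat; apply INR_S_pos|].
  right. rewrite (S_INR (S n)). field. lra.
Qed.

Lemma lnS_diff_ge (n : nat) : / INR (S (S n)) <= lnS (S n) - lnS n.
Proof.
  assert (H := INR_S_pos n). assert (H' := INR_S_pos (S n)).
  unfold lnS. 
  assert (Hd := ln_le_sub_1 (INR (S n) / INR (S (S n))) ltac:(apply Rdiv_lt_0_compat; assumption)).
  rewrite ln_div in Hd by assumption.
  replace (INR (S n) / INR (S (S n)) - 1) with (- / INR (S (S n))) in Hd; [lra|].
  rewrite (S_INR (S n)). field. rewrite (S_INR (S n)) in H'. lra.
Qed.

(** Discrete comparison with the integral of x^(-1-tau), from [1 + x <= exp x] and the lower bound
    [lnS_diff_ge]. *)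
Lemma exp_lnS_telescope (tau : R) (n : nat) :
  0 < tau ->
  exp (- (1 + tau) * lnS (S n)) <= (exp (- tau * lnS n) - exp (- tau * lnS (S n))) / tau.
Proof.
  intros Ht. apply Rmult_le_reg_r with tau; [exact Ht|].
  replace ((exp (- tau * lnS n) - exp (- tau * lnS (S n))) / tau * tau) with
    (exp (- tau * lnS n) - exp (- tau * lnS (S n))) by (field; lra).
  replace (- tau * lnS n) with (- tau * lnS (S n) + tau * (lnS (S n) - lnS n)) by ring.
  replace (- (1 + tau) * lnS (S n)) with (- tau * lnS (S n) + - lnS (S n)) by ring.
  rewrite !exp_plus, exp_Ropp, exp_lnS.
  assert (H1 := exp_ineq1_le (tau * (lnS (S n) - lnS n))).
  assert (H2 := lnS_diff_ge n).
  assert (H3 := exp_pos (- tau * lnS (S n))).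
  assert (tau * / INR (S (S n)) <= tau * (lnS (S n) - lnS n)) by (apply Rmult_le_compat_l; lra).
  nra.
Qed.

Lemma rsum_exp_lnS_le (tau : R) (N : nat) :
  0 < tau -> rsum (fun n => exp (- (1 + tau) * lnS n)) N <= 1 + / tau.
Proof.
  intros Ht. assert (Hi := Rinv_0_lt_compat tau Ht).
  destruct N as [|N]; [simpl; lra|].
  apply Rle_trans with (1 + (1 - exp (- tau * lnS N)) / tau).
  - induction N as [|N IH].
    + simpl. rewrite lnS_0, !Rmult_0_r, exp_0. right. field. lra.
    + change (rsum ?f (S (S N))) with (rsum f (S N) + f (S N)).
      assert (H := exp_lnS_telescope tau N Ht). cbv beta in *.
      replace ((1 - exp (- tau * lnS (S N))) / tau) with
        ((1 - exp (- tau * lnS N)) / tau + (exp (- tau * lnS N) - exp (- tau * lnS (S N))) / tau)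
        by (field; lra).
      lra.
  - assert (H := exp_pos (- tau * lnS N)). unfold Rdiv. nra.
Qed.

Lemma exp_lnS_lim (tau : R) : 0 < tau -> is_lim_seq (fun n => exp (- tau * lnS n)) 0.
Proof.
  intros Ht. apply is_lim_comp_seq with (f := exp) (x := m_infty).
  - apply is_lim_exp_m.
  - exists O. discriminate.
  - replace m_infty with (Rbar_mult (- tau) p_infty).
    + apply is_lim_seq_scal_l. unfold lnS.
      apply is_lim_comp_seq with (f := ln) (x := p_infty).
      * apply is_lim_ln_p.
      * exists O. discriminate.
      * apply (is_lim_seq_incr_1 INR), is_lim_seq_INR.
    + simpl. destruct (Rle_dec 0 (- tau)); [exfalso; lra|reflexivity].
Qed.

(* Summands of the telescoped series (z-1) zeta(z) = 1 + sum_n [(z-1) n^(-z) + (n+1)^(1-z) - n^(1-z)]. *)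
Definition zeta_term (n : nat) (z : C) : C :=
  ((z - RtoC 1) * npow n (- z) + npow (S n) (RtoC 1 - z) - npow n (RtoC 1 - z))%C.

Lemma zeta_term_csum (z : C) (N : nat) :
  csum (fun n => zeta_term n z) N =
  ((z - RtoC 1) * csum (fun n => npow n (- z)) N + npow N (RtoC 1 - z) - RtoC 1)%C.
Proof.
  induction N as [|N IH].
  - simpl csum. rewrite npow_0. ring.
  - simpl csum. rewrite IH. unfold zeta_term. ring.
Qed.

(** The orders 0 and 1 in the logarithmic step cancel, and both remaining summands in the bracket
    are O(n^(-2)). Hence the term is O(n^(-1 - Re z)), summable as soon as Re z > 0. *)
Lemma zeta_term_factor (n : nat) (z : C) :
  zeta_term n z =
  (npow n (RtoC 1 - z) *
   ((Cexp (RtoC (lnS (S n) - lnS n) * (RtoC 1 - z)) - RtoC 1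
      - RtoC (lnS (S n) - lnS n) * (RtoC 1 - z))
    + RtoC (lnS (S n) - lnS n - / INR (S n)) * (RtoC 1 - z)))%C.
Proof.
  unfold zeta_term.
  assert (H1 : npow (S n) (RtoC 1 - z)%C =
    (npow n (RtoC 1 - z) * Cexp (RtoC (lnS (S n) - lnS n) * (RtoC 1 - z)))%C).
  { unfold npow, Rpow_C. rewrite <- Cexp_plus. f_equal. rewrite RtoC_minus.
    unfold lnS. ring. }
  assert (H2 : npow n (RtoC 1 - z)%C = (RtoC (INR (S n)) * npow n (- z))%C).
  { rewrite <- npow_1, <- npow_plus. reflexivity. }
  assert (H3 : RtoC (INR (S n)) <> RtoC 0).
  { intros H. injection H. apply Rgt_not_eq, INR_S_pos. }
  rewrite H1, H2, !RtoC_minus, RtoC_inv by (apply Rgt_not_eq, INR_S_pos).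
  field. exact H3.
Qed.

Lemma wiener_one_sub (r : R) (s : C) :
  0 <= r -> wiener r (fun w => RtoC 1 - (s + w))%C (Cmod (RtoC 1 - s)%C + r).
Proof.
  intros Hr.
  apply wiener_ext with (fun w => (RtoC 1 - s) + (- RtoC 1) * w)%C
    (Cmod (RtoC 1 - s)%C + Cmod (- RtoC 1)%C * r).
  - intros; ring.
  - rewrite Cmod_opp, Cmod_1. lra.
  - apply wiener_plus; [exact Hr|apply wiener_const|]. now apply wiener_scal, wiener_id.
Qed.

(** The factor (n+1)^(-w) has norm (n+1)^r on the disc, so the decay exponent drops from 1 + Re s to
    1 + Re s - r; the rest is bounded uniformly in n after extracting (n+1)^(-2). *)
Lemma wiener_zeta_term (r : R) (s : C) (n : nat) :
  0 < r ->
  wiener r (fun w => zeta_term n (s + w)%C)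
    ((exp (Cmod (RtoC 1 - s)%C + r) + (Cmod (RtoC 1 - s)%C + r))
     * exp (- (1 + (Re s - r)) * lnS n)).
Proof.
  intros Hr. set (X := Cmod (RtoC 1 - s)%C + r).
  assert (HX : 0 <= X) by (unfold X; generalize (Cmod_ge_0 (RtoC 1 - s)%C); lra).
  set (d := lnS (S n) - lnS n). set (x := INR (S n)).
  assert (Hx : 1 <= x) by (unfold x; rewrite S_INR; generalize (pos_INR n); lra).
  assert (Hd1 : d <= / x) by apply lnS_diff_le.
  assert (Hd2 : / (x + 1) <= d) by (unfold x; rewrite <- S_INR; apply lnS_diff_ge).
  assert (Hix : 0 < / x) by (apply Rinv_0_lt_compat; lra).
  assert (Hix1 : / x <= 1) by (rewrite <- Rinv_1; apply Rinv_le_contravar; lra).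
  assert (Hd0 : 0 < / (x + 1)) by (apply Rinv_0_lt_compat; lra).
  (* Together with [Hd1] and [Hd2] this gives |d - 1/x| <= 1/x^2, the same order as the bound for
     d^2. *)
  assert (Hd3 : / x - / x ^ 2 <= / (x + 1)).
  { apply Rmult_le_reg_r with (x ^ 2 * (x + 1)); [nra|].
    field_simplify; lra. }
  assert (Hone : wiener r (fun w => RtoC 1 - (s + w))%C X) by (apply wiener_one_sub; lra).
  apply wiener_ext with
    (fun w => (npow n (RtoC 1 - s) * Cexp (RtoC (- lnS n) * w)) *
       ((Cexp (RtoC d * (RtoC 1 - (s + w))) - RtoC 1 - RtoC d * (RtoC 1 - (s + w)))
        + RtoC (d - / x) * (RtoC 1 - (s + w))))%C
    ((Cmod (npow n (RtoC 1 - s)%C) * exp (Cmod (RtoC (- lnS n)) * r)) *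
     (d ^ 2 * exp X + Cmod (RtoC (d - / x)) * X)).
  - intros w _. rewrite zeta_term_factor. fold d x. f_equal.
    replace (RtoC 1 - (s + w))%C with ((RtoC 1 - s) + - w)%C by ring.
    rewrite npow_plus. f_equal. unfold npow, Rpow_C. f_equal. rewrite RtoC_opp. unfold lnS. ring.
  - rewrite !Cmod_R, Cmod_npow, Rabs_Ropp, (Rabs_pos_eq (lnS n)) by apply lnS_nonneg.
    rewrite Rabs_left1 by lra.
    apply Rle_trans with (exp (Re (RtoC 1 - s)%C * lnS n) * exp (lnS n * r) *
      (/ x ^ 2 * (exp X + X))).
    + apply Rmult_le_compat_l; [apply Rmult_le_pos; apply Rlt_le, exp_pos|].
      assert (d ^ 2 <= / x ^ 2).
      { rewrite <- pow_inv. apply pow_incr. lra. }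
      assert (HeX := exp_pos X). nra.
    + right. replace (/ x ^ 2) with (exp (- lnS n) * exp (- lnS n)).
      * replace (- (1 + (Re s - r)) * lnS n) with
          (Re (RtoC 1 - s)%C * lnS n + (lnS n * r + (- lnS n + - lnS n))).
        { rewrite !exp_plus. ring. }
        destruct s; unfold Re, Cminus, RtoC, Copp, Cplus; simpl; ring.
      * rewrite exp_Ropp, exp_lnS. fold x. field. lra.
  - apply wiener_mult; [exact Hr| |].
    + apply wiener_scal, wiener_exp; [exact Hr|]. apply wiener_scal, wiener_id; lra.
    + apply wiener_plus; [lra| |].
      * apply wiener_exp_remainder; [exact Hr| |exact Hone]. lra.
      * now apply wiener_scal.
Qed.

Lemma zeta_term_bound_sum (r : R) (s : C) (K : R) (N : nat) :
  0 <= K -> r < Re s ->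
  rsum (fun n => K * exp (- (1 + (Re s - r)) * lnS n)) N <= K * (1 + / (Re s - r)).
Proof.
  intros HK Hr. rewrite rsum_scal. apply Rmult_le_compat_l; [exact HK|].
  apply rsum_exp_lnS_le. lra.
Qed.

Lemma zeta_term_cv (z : C) :
  0 < Re z -> exists l, clim (csum (fun n => zeta_term n z)) l.
Proof.
  intros Hz. set (r := Re z / 2).
  set (K := exp (Cmod (RtoC 1 - z)%C + r) + (Cmod (RtoC 1 - z)%C + r)).
  assert (HK : 0 <= K).
  { unfold K, r. generalize (Cmod_ge_0 (RtoC 1 - z)%C) (exp_pos (Cmod (RtoC 1 - z)%C + Re z / 2)).
    lra. }
  apply csum_abs_cv with (fun n => K * exp (- (1 + (Re z - r)) * lnS n)) (K * (1 + / (Re z - r))).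
  - intros n. replace z with (z + RtoC 0)%C at 1 by ring.
    apply (wiener_bound r (fun w => zeta_term n (z + w)%C)).
    + apply wiener_zeta_term. unfold r; lra.
    + rewrite Cmod_0. unfold r; lra.
  - intros N. apply zeta_term_bound_sum; [exact HK|unfold r; lra].
Qed.

Definition zeta_term_sum (z : C) : C :=
  epsilon (inhabits (RtoC 0)) (clim (csum (fun n => zeta_term n z))).

Lemma zeta_term_sum_lim (z : C) :
  0 < Re z -> clim (csum (fun n => zeta_term n z)) (zeta_term_sum z).
Proof. intros Hz. exact (epsilon_spec _ _ (zeta_term_cv z Hz)). Qed.

Definition zeta_ext (z : C) : C := ((RtoC 1 + zeta_term_sum z) * / (z - RtoC 1))%C.

Lemma zeta_ext_lim (z : C) :
  0 < Re z -> z <> RtoC 1 ->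
  clim (fun N => csum (fun n => npow n (- z)) N + npow N (RtoC 1 - z) / (z - RtoC 1))%C
       (zeta_ext z).
Proof.
  intros Hz Hz1. unfold zeta_ext.
  assert (H := zeta_term_sum_lim z Hz).
  assert (Hne : (z - RtoC 1)%C <> RtoC 0).
  { intros E. apply Hz1. replace z with ((z - RtoC 1) + RtoC 1)%C by ring. rewrite E. ring. }
  rewrite Cmult_comm.
  apply clim_ext with (fun N => / (z - RtoC 1) * (RtoC 1 + csum (fun n => zeta_term n z) N))%C.
  - intros N. rewrite zeta_term_csum. field. exact Hne.
  - apply clim_scal, clim_plus; [apply clim_const|exact H].
Qed.

(** Geometric series in -w/rho; [2 * r <= Cmod rho] keeps the ratio at most 1/2, whence the factor
    2. *)
Lemma wiener_inv (r : R) (rho : C) :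
  0 < r -> 2 * r <= Cmod rho -> wiener r (fun w => / (rho + w))%C (2 / Cmod rho).
Proof.
  intros Hr Hrho.
  assert (Hne : rho <> RtoC 0) by (apply Cmod_gt_0; lra).
  assert (Hi : 0 < / Cmod rho) by (apply Rinv_0_lt_compat; lra).
  apply wiener_sum with (fun m w => / rho * (- / rho * w) ^ m)%C
    (fun m => / Cmod rho * (1 / 2) ^ m); [exact Hr| | |].
  - intros m.
    apply wiener_ext with (fun w => / rho * (- / rho * w) ^ m)%C
      (Cmod (/ rho)%C * (Cmod (- / rho)%C * r) ^ m); [reflexivity| |].
    + rewrite Cmod_opp, Cmod_inv by assumption.
      apply Rmult_le_compat_l; [lra|]. apply pow_incr. split; [nra|].
      apply Rmult_le_reg_l with (Cmod rho); [lra|]. field_simplify; lra.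
    + apply wiener_scal, wiener_pow; [exact Hr|]. apply wiener_scal, wiener_id. lra.
  - intros N. rewrite rsum_scal. replace (2 / Cmod rho) with (/ Cmod rho * 2) by (unfold Rdiv; ring).
    apply Rmult_le_compat_l; [lra|].
    apply Rle_trans with (2 - 2 * (1 / 2) ^ N).
    + right. induction N as [|N IH]; simpl; [ring|rewrite IH; field].
    + assert (0 <= (1 / 2) ^ N) by (apply pow_le; lra). lra.
  - intros w Hw.
    assert (Hnw : (rho + w)%C <> RtoC 0).
    { apply Cmod_gt_0. assert (H := Cmod_triangle (rho + w)%C (- w)%C).
      replace (rho + w + - w)%C with rho in H by ring. rewrite Cmod_opp in H. lra. }
    apply clim_le with (fun N => Cmod (/ (rho + w))%C * (1 / 2) ^ N).
    + intros N.
      replace (csum (fun m => / rho * (- / rho * w) ^ m) N - / (rho + w))%C with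
        (- (/ (rho + w) * (- / rho * w) ^ N))%C.
      * rewrite Cmod_opp, Cmod_mult, Cmod_pow. apply Rmult_le_compat_l; [apply Cmod_ge_0|].
        apply pow_incr. split; [apply Cmod_ge_0|].
        rewrite Cmod_mult, Cmod_opp, Cmod_inv by assumption.
        apply Rmult_le_reg_l with (Cmod rho); [lra|]. field_simplify; lra.
      * induction N as [|N IH].
        { simpl. ring. }
        { change (csum ?f (S N)) with (csum f N + f N)%C. cbv beta. rewrite Cpow_S.
          transitivity (- (/ (rho + w) * (- / rho * w) ^ N) + / rho * (- / rho * w) ^ N)%C.
          - field. split; assumption.
          - rewrite IH. ring. }
    + replace (Finite 0) with (Finite (Cmod (/ (rho + w))%C * 0)) by (f_equal; ring).
      apply (is_lim_seq_scal_l _ _ 0). apply is_lim_seq_geom. rewrite Rabs_pos_eq; lra.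
Qed.

Lemma zeta_ext_continuation : zeta_continuation 0 zeta_ext.
Proof.
  split.
  - intros s Hs. apply is_series_clim.
    assert (Hs1 : s <> RtoC 1) by (intros ->; simpl in Hs; lra).
    assert (H := zeta_ext_lim s ltac:(lra) Hs1).
    (* For Re s > 1 the correction (N+1)^(1-s)/(s-1) vanishes in the limit and the Dirichlet series
       alone remains. *)
    assert (H0 : clim (fun N => (- / (s - RtoC 1)) * npow N (RtoC 1 - s))%C
                      ((- / (s - RtoC 1)) * RtoC 0)%C).
    { apply clim_scal. unfold clim.
      apply is_lim_seq_ext with (fun n => exp (- (Re s - 1) * lnS n)); [|apply exp_lnS_lim; lra].
      intros n. replace (npow n (RtoC 1 - s) - RtoC 0)%C with (npow n (RtoC 1 - s)) by ring.
      rewrite Cmod_npow. f_equal.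
      destruct s; unfold Re, Cminus, RtoC, Copp, Cplus; simpl; ring. }
    assert (H1 := clim_plus _ _ _ _ H H0).
    replace (zeta_ext s) with (zeta_ext s + - / (s - RtoC 1) * RtoC 0)%C by ring.
    revert H1. apply clim_ext. intros N. unfold npow. unfold Cdiv. ring.
  - intros s Hs Hs1.
    assert (Hne : (s - RtoC 1)%C <> RtoC 0).
    { intros E. apply Hs1. replace s with ((s - RtoC 1) + RtoC 1)%C by ring. rewrite E. ring. }
    assert (Hm : 0 < Cmod (s - RtoC 1)%C) by now apply Cmod_gt_0.
    (* The first bound keeps the disc inside Re > 0, where the series converges; the second is the
       margin [wiener_inv] asks for around the pole. *)
    set (r := Rmin (Re s / 2) (Cmod (s - RtoC 1)%C / 2)).
    assert (Hr : 0 < r) by (apply Rmin_pos; lra).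
    assert (Hr1 : r <= Re s / 2) by apply Rmin_l.
    assert (Hr2 : r <= Cmod (s - RtoC 1)%C / 2) by apply Rmin_r.
    eapply wiener_analytic with (r := r); [exact Hr|].
    unfold zeta_ext. apply wiener_mult; [exact Hr| |].
    + apply wiener_plus; [lra|apply wiener_const|].
      eapply wiener_sum with (fs := fun n w => zeta_term n (s + w)%C); [exact Hr| | |].
      * intros n. now apply wiener_zeta_term.
      * intros N. apply zeta_term_bound_sum; [|lra].
        generalize (Cmod_ge_0 (RtoC 1 - s)%C) (exp_pos (Cmod (RtoC 1 - s)%C + r)). lra.
      * intros w Hw.
        apply zeta_term_sum_lim.
        assert (Hre := re_le_Cmod w). apply Rabs_le_between in Hre.
        replace (Re (s + w)%C) with (Re s + Re w) by reflexivity. lra.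
    + eapply wiener_ext; [| |apply wiener_inv with (rho := (s - RtoC 1)%C); [exact Hr|lra]].
      * intros w _. simpl. f_equal. ring.
      * apply Rle_refl.
Qed.

(** * Uniqueness of the continuation *)

(** Restriction to a line, followed by [Re (c * _)], turns the identity theorem into a statement on
    real power series. *)
Definition real_analytic_at (u : R -> R) (x0 : R) : Prop :=
  exists (a : nat -> R) (d : R), 0 < d /\
    forall x, Rabs x < d -> is_pseries a x (u (x0 + x)).

Lemma CV_radius_decr_n (a : nat -> R) (n : nat) : CV_radius (PS_decr_n a n) = CV_radius a.
Proof.
  induction n as [|n IH].
  - apply CV_radius_ext. reflexivity.
  - rewrite <- IH, <- (CV_radius_decr_1 (PS_decr_n a n)). apply CV_radius_ext.
    intros k. unfold PS_decr_n, PS_decr_1. f_equal. lia.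
Qed.

(** The coefficients vanish one by one: once those below n do, u is x^n times a continuous power
    series with value a_n at 0, and this factor is 0 at all small x > 0. Vanishing on one side is
    the form that a supremum argument supplies. *)
Lemma real_analytic_zero_right (u : R -> R) (x0 : R) :
  real_analytic_at u x0 ->
  (exists e, 0 < e /\ forall x, 0 < x < e -> u (x0 + x) = 0) ->
  exists d, 0 < d /\ forall x, Rabs x < d -> u (x0 + x) = 0.
Proof.
  intros [a [d [Hd Ha]]] [e [He Hu]].
  (* The series converges at d/2, whereas outside the disc of convergence its terms would not tend
     to 0. *)
  assert (Hrad : Rbar_lt 0 (CV_radius a)).
  { apply Rbar_lt_le_trans with (d / 2); [simpl; lra|].
    apply Rbar_not_lt_le. intros Hlt.
    apply (CV_disk_outside a (d / 2)); [rewrite Rabs_pos_eq by lra; exact Hlt|].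
    assert (Hs := Ha (d / 2) ltac:(rewrite Rabs_pos_eq; lra)).
    apply is_pseries_R in Hs. apply ex_series_lim_0. eexists; exact Hs. }
  assert (Hz : forall n k, (k < n)%nat -> a k = 0).
  { induction n as [|n IH]; intros k Hk; [lia|].
    destruct (Nat.eq_dec k n) as [->|Hne]; [|apply IH; lia].
    set (b := PS_decr_n a n).
    replace (a n) with (PSeries b 0) by (rewrite PSeries_0; unfold b, PS_decr_n; f_equal; lia).
    assert (Hc : continuity_pt (PSeries b) 0).
    { apply PSeries_continuity. unfold b. rewrite CV_radius_decr_n, Rabs_R0. exact Hrad. }
    assert (Hb : forall x, 0 < x < Rmin d e -> PSeries b x = 0).
    { intros x [Hx0 Hx]. assert (x < d) by (eapply Rlt_le_trans; [exact Hx|apply Rmin_l]).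
      assert (x < e) by (eapply Rlt_le_trans; [exact Hx|apply Rmin_r]).
      assert (E := Ha x ltac:(rewrite Rabs_pos_eq; lra)).
      apply is_pseries_unique in E. rewrite (Hu x) in E by lra.
      rewrite (PSeries_decr_n_aux a n x IH) in E. 
      apply Rmult_integral in E as [E|E]; [|exact E].
      exfalso. revert E. apply pow_nonzero. lra. }
    destruct (Req_dec (PSeries b 0) 0) as [E|E]; [exact E|exfalso].
    destruct (Hc (Rabs (PSeries b 0)) (Rabs_pos_lt _ E)) as [al [Hal H]].
    assert (Hm : 0 < Rmin al (Rmin d e)) by (repeat apply Rmin_pos; lra).
    set (x := Rmin al (Rmin d e) / 2).
    assert (Hx1 : Rmin al (Rmin d e) <= al) by apply Rmin_l.
    assert (Hx2 : Rmin al (Rmin d e) <= Rmin d e) by apply Rmin_r.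
    specialize (H x). unfold dist in H; simpl in H. unfold Rdist in H.
    rewrite (Hb x) in H by (unfold x; lra).
    rewrite !Rminus_0_r, Rminus_0_l, Rabs_Ropp in H.
    apply (Rlt_irrefl (Rabs (PSeries b 0))), H.
    split; [split; [exact I|unfold x; lra]|].
    rewrite Rabs_pos_eq; unfold x; lra. }
  exists d. split; [exact Hd|]. intros x Hx.
  rewrite <- (is_pseries_unique _ _ _ (Ha x Hx)).
  rewrite (PSeries_ext a (fun _ => 0)) by (intros n; apply (Hz (S n)); lia).
  apply PSeries_const_0.
Qed.

(** Connectedness through a supremum m of the points with u <> 0: u vanishes to the right of m,
    hence in a neighbourhood of m, so a smaller upper bound exists. *)
Lemma real_analytic_zero_half_line (u : R -> R) (al be : R) :
  (forall x, al < x -> real_analytic_at u x) -> (forall x, be < x -> u x = 0) ->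
  forall x, al < x -> u x = 0.
Proof.
  intros Han Hbe x1 Hx1. apply NNPP. intros Hne.
  destruct (completeness (fun x => al < x /\ u x <> 0)) as [m [Hub Hlub]].
  - exists be. intros x [_ Hx]. apply Rnot_lt_le. intros H. now apply Hx, Hbe.
  - now exists x1.
  - assert (Hm : al < m) by (eapply Rlt_le_trans; [exact Hx1|]; now apply Hub).
    destruct (real_analytic_zero_right u m (Han m Hm)) as [d [Hd H]].
    + exists 1. split; [lra|]. intros x Hx. apply NNPP. intros Hn.
      assert (m + x <= m) by (apply Hub; split; [lra|exact Hn]). lra.
    + assert (m <= m - d / 2); [|lra].
      apply Hlub. intros x [Hx Hux]. apply Rnot_lt_le. intros Hlt.
      assert (x <= m) by now apply Hub.
      apply Hux. replace x with (m + (x - m)) by ring. apply H.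
      rewrite Rabs_left1; lra.
Qed.

Lemma is_series_rsum (a : nat -> R) (l : R) : is_lim_seq (rsum a) l -> is_series a l.
Proof.
  intros H. apply is_lim_seq_incr_1 in H. apply is_lim_seq_ext with (2 := H). intros n.
  induction n as [|n IH]; [rewrite sum_O; simpl; ring|]. rewrite sum_Sn, <- IH. reflexivity.
Qed.

(** A unit direction [d] preserves the radius, and the free factor [c] lets real parts alone
    determine the complex value, by [Re_Im_test_eq]. *)
Lemma analytic_restrict (f : C -> C) (p c d : C) (t0 : R) :
  Cmod d = 1 -> analytic_at f (p + RtoC t0 * d)%C ->
  real_analytic_at (fun t => Re (c * f (p + RtoC t * d))%C) t0.
Proof.
  intros Hd [a [eps H]]. exists (fun k => Re (c * (d ^ k * a k))%C), eps.
  split; [apply cond_pos|]. intros x Hx.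
  set (q := (p + RtoC t0 * d)%C) in *.
  replace (p + RtoC (t0 + x) * d)%C with (q + RtoC x * d)%C
    by (unfold q; rewrite RtoC_plus; ring).
  assert (Hb : ball (M := C_UniformSpace) q eps (q + RtoC x * d)%C).
  { assert (Hq : Cmod (RtoC x * d)%C < eps) by (rewrite Cmod_mult, Cmod_R, Hd; lra).
    assert (H1 := Rmax_Cmod (RtoC x * d)%C). 
    assert (H2 := Rmax_l (Rabs (fst (RtoC x * d)%C)) (Rabs (snd (RtoC x * d)%C))).
    assert (H3 := Rmax_r (Rabs (fst (RtoC x * d)%C)) (Rabs (snd (RtoC x * d)%C))).
    split.
    - change (Rabs ((fst q + fst (RtoC x * d)%C) - fst q) < eps).
      replace (fst q + fst (RtoC x * d)%C - fst q) with (fst (RtoC x * d)%C) by ring. lra.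
    - change (Rabs ((snd q + snd (RtoC x * d)%C) - snd q) < eps).
      replace (snd q + snd (RtoC x * d)%C - snd q) with (snd (RtoC x * d)%C) by ring. lra. }
  apply H in Hb. apply is_series_clim in Hb.
  apply (clim_scal c), clim_Re in Hb.
  apply is_pseries_R, is_series_rsum. revert Hb. apply is_lim_seq_ext. intros n.
  rewrite <- csum_scal, csum_Re. apply rsum_ext. intros k _.
  change (Re (c * (pow_n (K := C_AbsRing) (q + RtoC x * d - q) k * a k))%C =
    Re (c * (d ^ k * a k))%C * x ^ k).
  replace (pow_n (K := C_AbsRing) (q + RtoC x * d - q)%C k) with (RtoC (x ^ k) * d ^ k)%C.
  - rewrite Rmult_comm, <- Re_RtoC_mult. f_equal. ring.
  - transitivity ((q + RtoC x * d - q) ^ k)%C; [|symmetry; apply pow_n_Cpow].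
    rewrite RtoC_pow, <- Cpow_mult_l. f_equal. ring.
Qed.

Lemma Re_Im_test_eq (z w : C) : (forall c : C, Re (c * z)%C = Re (c * w)%C) -> z = w.
Proof.
  intros H. assert (H1 := H (RtoC 1)). assert (H2 := H Ci).
  destruct z, w. unfold Re, Ci, RtoC, Cmult in *; simpl in *. f_equal; lra.
Qed.

Lemma real_analytic_minus (u v : R -> R) (x : R) :
  real_analytic_at u x -> real_analytic_at v x -> real_analytic_at (fun t => u t - v t) x.
Proof.
  intros [a [d [Hd Ha]]] [b [e [He Hb]]]. exists (PS_minus a b), (Rmin d e).
  split; [now apply Rmin_pos|]. intros y Hy.
  apply (is_pseries_minus a b y (u (x + y)) (v (x + y))).
  - apply Ha. eapply Rlt_le_trans; [exact Hy|apply Rmin_l].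
  - apply Hb. eapply Rlt_le_trans; [exact Hy|apply Rmin_r].
Qed.

Lemma continuation_unique_gt1 (a b : R) (f g : C -> C) (s : C) :
  zeta_continuation a f -> zeta_continuation b g -> 1 < Re s -> f s = g s.
Proof.
  intros [Hf _] [Hg _] Hs. specialize (Hf s Hs). specialize (Hg s Hs).
  apply is_series_clim in Hf, Hg. exact (clim_unique _ _ _ Hf Hg).
Qed.

(* A horizontal line off the real axis avoids the pole and reaches Re > 1. *)
Lemma continuation_unique_nonreal (a b : R) (f g : C -> C) (s : C) :
  zeta_continuation a f -> zeta_continuation b g ->
  a < Re s -> b < Re s -> Im s <> 0 -> f s = g s.
Proof.
  intros Hf Hg Ha Hb Hs. apply Re_Im_test_eq. intros c.
  set (p := (0, Im s) : C).
  assert (Hp : forall t, (p + RtoC t * RtoC 1)%C = (t, Im s)).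
  { intros t. unfold p, RtoC, Cplus, Cmult; simpl. f_equal; ring. }
  apply Rminus_diag_uniq.
  replace s with (p + RtoC (Re s) * RtoC 1)%C by (rewrite Hp; now destruct s).
  apply (real_analytic_zero_half_line
    (fun t => Re (c * f (p + RtoC t * RtoC 1)%C)%C - Re (c * g (p + RtoC t * RtoC 1)%C)%C)
    (Rmax a b) 1).
  - intros x Hx.
    assert (a <= Rmax a b) by apply Rmax_l. assert (b <= Rmax a b) by apply Rmax_r.
    apply real_analytic_minus; (apply analytic_restrict; [apply Cmod_1|rewrite Hp]).
    + apply Hf; [simpl; lra|]. intros E. injection E. intros E1 _. now apply Hs.
    + apply Hg; [simpl; lra|]. intros E. injection E. intros E1 _. now apply Hs.
  - intros x Hx. rewrite (continuation_unique_gt1 a b f g); try assumption; [ring|].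
    rewrite Hp. exact Hx.
  - now apply Rmax_lub_lt.
Qed.

(** The real axis to the left of 1 is cut off from Re > 1 by the pole. A real s is instead
    approached along its vertical line, all of whose other points are nonreal and already
    settled. *)
Lemma continuation_unique (a b : R) (f g : C -> C) (s : C) :
  zeta_continuation a f -> zeta_continuation b g ->
  a < Re s -> b < Re s -> s <> RtoC 1 -> f s = g s.
Proof.
  intros Hf Hg Ha Hb Hs.
  destruct (Req_dec (Im s) 0) as [H0|H0]; [|now apply (continuation_unique_nonreal a b)].
  apply Re_Im_test_eq. intros c.
  assert (Hp : forall t, (s + RtoC t * Ci)%C = (Re s, t)).
  { intros t. destruct s as [x y]. simpl in H0. subst y.
    unfold Ci, RtoC, Cplus, Cmult; simpl. f_equal; ring. }
  assert (Hs0 : (s + RtoC 0 * Ci)%C = s) by ring.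
  destruct (real_analytic_zero_right
    (fun t => Re (c * f (s + RtoC t * Ci)%C)%C - Re (c * g (s + RtoC t * Ci)%C)%C) 0)
    as [d [Hd H]].
  - apply real_analytic_minus; (apply analytic_restrict; [apply Cmod_Ci|rewrite Hs0]).
    + now apply Hf.
    + now apply Hg.
  - exists 1. split; [lra|]. intros x Hx.
    rewrite (continuation_unique_nonreal a b f g); try assumption; [ring| | |];
      rewrite Hp; simpl; lra.
  - specialize (H 0). rewrite Rabs_R0 in H. specialize (H Hd).
    replace (0 + 0) with 0 in H by ring. rewrite Hs0 in H. lra.
Qed.

Lemma zeta_eq_ext (s : C) : 0 < Re s -> s <> RtoC 1 -> zeta s = zeta_ext s.
Proof.
  intros Hs Hs1. unfold zeta.
  match goal with |- epsilon ?i ?P = _ =>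
    assert (H : P (epsilon i P)) end.
  { apply epsilon_spec. exists (zeta_ext s), 0, zeta_ext.
    split; [exact Hs|split; [apply zeta_ext_continuation|reflexivity]]. }
  cbv beta in H. destruct H as [a [f [Ha [Hf E]]]]. rewrite E.
  apply (continuation_unique a 0); auto using zeta_ext_continuation.
Qed.

(** * Convergence of the alternating series *)

(** Signs are counted from the start of the block. They agree with those of the full series exactly
    when [p] is even, so sums are split at even indices only. *)
Definition alt_sum (p L : nat) (s : C) : C :=
  csum (fun j => RtoC ((-1) ^ j) * npow (p + j) (- s))%C L.

Lemma Rpow_C_mult_base (x y : R) (z : C) :
  0 < x -> 0 < y -> Rpow_C (x * y) z = (Rpow_C x z * Rpow_C y z)%C.
Proof.
  intros Hx Hy. unfold Rpow_C. rewrite ln_mult, <- Cexp_plus by assumption.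
  f_equal. rewrite RtoC_plus. ring.
Qed.

(** By the index shift, the odd index 2N+1 stands for the even integer 2(N+1). *)
Lemma npow_odd (N : nat) (z : C) : npow (S (2 * N)) z = (Rpow_C 2 z * npow N z)%C.
Proof.
  unfold npow. rewrite <- Rpow_C_mult_base; [|lra|apply INR_S_pos].
  f_equal. rewrite !S_INR, mult_INR. simpl. ring.
Qed.

Lemma Rpow_C_2_one_sub (s : C) : Rpow_C 2 (RtoC 1 - s)%C = (RtoC 2 * Rpow_C 2 (- s))%C.
Proof.
  unfold Rpow_C. replace ((RtoC 1 - s) * RtoC (ln 2))%C with (RtoC (ln 2) + - s * RtoC (ln 2))%C by ring.
  rewrite Cexp_plus, Cexp_RtoC, exp_ln by lra. reflexivity.
Qed.

Lemma pow_m1_even (N : nat) : (-1) ^ (2 * N) = 1.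
Proof. rewrite pow_mult. replace ((-1) ^ 2) with 1 by ring. apply pow1. Qed.

Lemma pow_m1_odd (N : nat) : (-1) ^ S (2 * N) = -1.
Proof. rewrite <- tech_pow_Rmult, pow_m1_even. ring. Qed.

Lemma alt_sum_even (N : nat) (s : C) :
  alt_sum 0 (2 * N) s =
  (csum (fun n => npow n (- s)) (2 * N)
   - Rpow_C 2 (RtoC 1 - s) * csum (fun n => npow n (- s)) N)%C.
Proof.
  unfold alt_sum. induction N as [|N IH]; [simpl; ring|].
  replace (2 * S N)%nat with (S (S (2 * N))) by lia.
  change (csum ?f (S (S (2 * N)))) with (csum f (2 * N) + f (2 * N)%nat + f (S (2 * N)))%C.
  change (csum ?f (S N)) with (csum f N + f N)%C. cbv beta.
  rewrite IH. rewrite pow_m1_even, pow_m1_odd. rewrite !Nat.add_0_l, npow_odd.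
  rewrite Rpow_C_2_one_sub. replace (RtoC (-1)) with (- RtoC 1)%C by (rewrite <- RtoC_opp; reflexivity).
  replace (RtoC 2) with (RtoC 1 + RtoC 1)%C by (rewrite <- RtoC_plus; f_equal; ring).
  ring.
Qed.

Lemma double_eventually : filterlim (fun n => (2 * n)%nat) eventually eventually.
Proof. apply eventually_subseq. intros; lia. Qed.

Lemma csum_term_lim (a : nat -> C) (l : C) : clim (csum a) l -> clim a (RtoC 0).
Proof.
  intros H. assert (H1 := proj1 (clim_incr _ _) H).
  apply (clim_scal (- RtoC 1)%C) in H.
  assert (H2 := clim_plus _ _ _ _ H1 H).
  replace (RtoC 0) with (l + - RtoC 1 * l)%C by ring.
  revert H2. apply clim_ext. intros n. simpl csum. ring.
Qed.

Lemma npow_opp_lim (s : C) : 0 < Re s -> clim (fun n => npow n (- s)) (RtoC 0).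
Proof.
  intros Hs. unfold clim.
  apply is_lim_seq_ext with (fun n => exp (- Re s * lnS n)); [|now apply exp_lnS_lim].
  intros n. replace (npow n (- s) - RtoC 0)%C with (npow n (- s)) by ring.
  now rewrite Cmod_npow.
Qed.

Lemma eta_lim_ne_1 (s : C) :
  0 < Re s -> s <> RtoC 1 ->
  clim (fun N => alt_sum 0 (2 * N) s) ((RtoC 1 - Rpow_C 2 (RtoC 1 - s)) * zeta_ext s)%C.
Proof.
  intros Hs Hs1.
  assert (Hne : (s - RtoC 1)%C <> RtoC 0).
  { intros E. apply Hs1. replace s with ((s - RtoC 1) + RtoC 1)%C by ring. rewrite E. ring. }
  assert (HZ := zeta_ext_lim s Hs Hs1).
  assert (HZ2 := clim_subseq _ _ _ double_eventually HZ). cbv beta in HZ2.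
  (* The corrections in the two limits do not cancel exactly: one is (2N+1)^(1-s)/(s-1), the other
     2^(1-s) (N+1)^(1-s)/(s-1) = (2N+2)^(1-s)/(s-1). The second minus the first is this expression
     at n = 2N; it tends to 0 because the terms of a convergent series and n^(-s) do. *)
  assert (Hd : clim (fun n => / (s - RtoC 1) * (zeta_term n s + (- (s - RtoC 1)) * npow n (- s)))%C
                    (/ (s - RtoC 1) * (RtoC 0 + (- (s - RtoC 1)) * RtoC 0))%C).
  { apply clim_scal, clim_plus.
    - apply csum_term_lim with (zeta_term_sum s). now apply zeta_term_sum_lim.
    - apply clim_scal. now apply npow_opp_lim. }
  apply (clim_subseq _ _ _ double_eventually) in Hd. cbv beta in Hd.
  assert (H := clim_plus _ _ _ _ (clim_plus _ _ _ _ HZ2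
    (clim_scal (- Rpow_C 2 (RtoC 1 - s))%C _ _ HZ)) Hd).
  replace ((RtoC 1 - Rpow_C 2 (RtoC 1 - s)) * zeta_ext s)%C with
    (zeta_ext s + - Rpow_C 2 (RtoC 1 - s) * zeta_ext s
     + / (s - RtoC 1) * (RtoC 0 + - (s - RtoC 1) * RtoC 0))%C by ring.
  revert H. apply clim_ext. intros N. rewrite alt_sum_even. unfold zeta_term.
  rewrite npow_odd. field. exact Hne.
Qed.

Lemma npow_opp_1 (n : nat) : npow n (- RtoC 1)%C = RtoC (/ INR (S n)).
Proof.
  unfold npow, Rpow_C. replace (- RtoC 1 * RtoC (ln (INR (S n))))%C with (RtoC (- ln (INR (S n))))
    by (rewrite RtoC_opp; ring).
  rewrite Cexp_RtoC, exp_Ropp, exp_ln by apply INR_S_pos. reflexivity.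
Qed.

(** Catalan's identity 1 - 1/2 + ... - 1/(2N) = 1/(N+1) + ... + 1/(2N); the positive block on the
    right can be compared with logarithms. *)
Lemma alt_harmonic_even (N : nat) :
  alt_sum 0 (2 * N) (RtoC 1) = RtoC (rsum (fun k => / INR (S (N + k))) N).
Proof.
  unfold alt_sum.
  induction N as [|N IH]; [reflexivity|].
  replace (2 * S N)%nat with (S (S (2 * N))) by lia.
  change (csum ?f (S (S (2 * N)))) with (csum f (2 * N) + f (2 * N)%nat + f (S (2 * N)))%C.
  cbv beta. rewrite IH, pow_m1_even, pow_m1_odd, !npow_opp_1, !Nat.add_0_l.
  rewrite <- !RtoC_mult, <- !RtoC_plus. f_equal.
  change (rsum ?f (S N)) with (rsum f N + f N). cbv beta.
  assert (E := rsum_shift (fun k => / INR (S (N + k))) N).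
  change (rsum ?f (S N)) with (rsum f N + f N) in E. cbv beta in E.
  rewrite Nat.add_0_r in E.
  rewrite (rsum_ext (fun k => / INR (S (S N + k))) (fun k => / INR (S (N + S k))))
    by (intros; do 3 f_equal; lia).
  replace (2 * N)%nat with (N + N)%nat by lia.
  assert (H1 := INR_S_pos N).
  replace (S N + N)%nat with (S (N + N)) by lia.
  replace (/ INR (S N)) with (2 * / INR (S (S (N + N)))) in E; [lra|].
  replace (S (S (N + N))) with (2 * S N)%nat by lia. rewrite mult_INR. simpl (INR 2). field. lra.
Qed.

Lemma harmonic_block_le (N m : nat) :
  rsum (fun k => / INR (S (S N + k))) m <= lnS (N + m) - lnS N.
Proof.
  induction m as [|m IH].
  - rewrite Nat.add_0_r. simpl; lra.
  - change (rsum ?f (S m)) with (rsum f m + f m). cbv beta.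
    assert (H := lnS_diff_ge (N + m)). 
    replace (S (S N + m)) with (S (S (N + m))) by lia.
    replace (N + S m)%nat with (S (N + m)) by lia. lra.
Qed.

Lemma harmonic_block_ge (N m : nat) :
  lnS (N + m) - lnS N <= rsum (fun k => / INR (S (N + k))) m.
Proof.
  induction m as [|m IH].
  - rewrite Nat.add_0_r. simpl; lra.
  - change (rsum ?f (S m)) with (rsum f m + f m). cbv beta.
    assert (H := lnS_diff_le (N + m)).
    replace (N + S m)%nat with (S (N + m)) by lia. lra.
Qed.

Lemma lnS_double (N : nat) : lnS (S (2 * N)) = ln 2 + lnS N.
Proof.
  unfold lnS. rewrite <- ln_mult; [|lra|apply INR_S_pos]. f_equal.
  rewrite !S_INR, mult_INR. simpl. ring.
Qed.

Lemma inv_INR_S_lim : is_lim_seq (fun n => / INR (S n)) 0.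
Proof.
  apply is_lim_seq_ext with (2 := exp_lnS_lim 1 Rlt_0_1).
  intros n. replace (- (1) * lnS n) with (- lnS n) by ring. rewrite exp_Ropp, exp_lnS. reflexivity.
Qed.

(** The formula with the denominator s - 1 breaks down here, so the value at the removable
    singularity is computed directly. With M = N+1, the block 1/(M+1) + ... + 1/(2M) is at most ln 2
    and falls short by at most ln((2M+2)/(2M+1)). *)
Lemma eta_lim_1 : clim (fun N => alt_sum 0 (2 * N) (RtoC 1)) (RtoC (ln 2)).
Proof.
  apply clim_incr.
  apply clim_le with (fun N => / INR (S N)); [|apply inv_INR_S_lim].
  intros N. rewrite alt_harmonic_even, <- RtoC_minus, Cmod_R.
  assert (H1 := harmonic_block_le N (S N)).
  assert (H2 := harmonic_block_ge (S N) (S N)).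
  replace (N + S N)%nat with (S (2 * N)) in H1 by lia.
  rewrite lnS_double in H1.
  replace (S N + S N)%nat with (2 * S N)%nat in H2 by lia.
  assert (H3 := lnS_double (S N)). assert (H4 := lnS_diff_le (2 * S N)).
  assert (/ INR (S (2 * S N)) <= / INR (S N)).
  { apply Rinv_le_contravar; [apply INR_S_pos|]. apply le_INR; lia. }
  apply Rabs_le. lra.
Qed.

Lemma eta_lim (s : C) :
  0 < Re s -> clim (fun N => alt_sum 0 (2 * N) s) (one_sub_two_pow_mul_zeta s).
Proof.
  intros Hs. unfold one_sub_two_pow_mul_zeta. destruct (Ceq_dec s (RtoC 1)) as [->|Hs1].
  - exact eta_lim_1.
  - rewrite zeta_eq_ext by assumption. now apply eta_lim_ne_1.
Qed.

(** * The Fourier transform of 1/(sg^2+t^2) *)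

Lemma nonincreasing_of_derive (f df : R -> R) (a b : R) :
  a <= b -> (forall x, a <= x <= b -> is_derive f x (df x)) ->
  (forall x, a <= x <= b -> df x <= 0) -> f b <= f a.
Proof.
  intros [Hab|Hab] Hd Hn; [|rewrite Hab; lra].
  destruct (MVT_cor2 f df a b Hab) as [c [E Hc]].
  - intros c Hc. apply is_derive_Reals, Hd, Hc.
  - assert (df c <= 0) by (apply Hn; lra). nra.
Qed.

Lemma continuous_of_pt (f : R -> R) (x : R) : continuity_pt f x -> continuous f x.
Proof. apply continuity_pt_filterlim. Qed.

Lemma continuity_pt_of_derive (f df : R -> R) (x : R) :
  is_derive f x (df x) -> continuity_pt f x.
Proof.
  intros H. apply continuity_pt_filterlim.
  apply (ex_derive_continuous (K := R_AbsRing) (V := R_NormedModule) f x). eexists; exact H.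
Qed.

Lemma is_derive_RInt_dilation (F F' g : R -> R) (a b x : R) :
  (forall y, is_derive F y (F' y)) -> (forall y, continuity_pt F' y) ->
  (forall t, continuity_pt g t) ->
  is_derive (fun x => RInt (fun t => F (x * t) * g t) a b) x
            (RInt (fun t => t * F' (x * t) * g t) a b).
Proof.
  intros HF HF' Hg.
  assert (HD : forall u t, is_derive (fun u => F (u * t) * g t) u (t * F' (u * t) * g t)).
  { intros u t. apply (is_derive_scal_l (fun u => F (u * t)) u (t * F' (u * t)) (g t)).
    apply (is_derive_comp F (fun u => u * t)); [apply HF|].
    auto_derive; [trivial|ring]. }
  replace (RInt (fun t => t * F' (x * t) * g t) a b) with
    (RInt (fun t => Derive (fun u => F (u * t) * g t) x) a b).
  2:{ apply RInt_ext. intros t _. apply is_derive_unique, HD. }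
  apply (is_derive_RInt_param (fun u t => F (u * t) * g t)).
  - apply filter_forall. intros u t _. eexists. apply HD.
  - intros t _.
    apply continuity_2d_pt_ext with (fun u v => v * F' (u * v) * g v).
    + intros u v. symmetry. apply is_derive_unique, HD.
    + apply continuity_2d_pt_mult.
      * apply continuity_2d_pt_mult; [apply continuity_2d_pt_id2|].
        apply continuity_1d_2d_pt_comp; [apply HF'|].
        apply continuity_2d_pt_mult; [apply continuity_2d_pt_id1|apply continuity_2d_pt_id2].
      * apply continuity_1d_2d_pt_comp; [apply Hg|apply continuity_2d_pt_id2].
  - apply filter_forall. intros u. apply (@ex_RInt_continuous R_CompleteNormedModule).
    intros z _. apply continuous_of_pt.
    apply (continuity_pt_mult (fun t => F (u * t)) g); [|apply Hg].
    apply (continuity_pt_comp (fun t => u * t) F).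
    + apply (continuity_pt_of_derive (fun t => u * t) (fun _ => u)). auto_derive; [trivial|ring].
    + apply (continuity_pt_of_derive F F'), HF.
Qed.

Lemma ex_RInt_ext_R (f g : R -> R) (a b : R) :
  (forall t, f t = g t) -> ex_RInt f a b -> ex_RInt g a b.
Proof. intros H. apply ex_RInt_ext. intros t _. apply H. Qed.

Lemma RInt_ext_R (f g : R -> R) (a b : R) : (forall t, f t = g t) -> RInt f a b = RInt g a b.
Proof. intros H. apply RInt_ext. intros t _. apply H. Qed.

Section Kernel.

Variable sg : R.
Hypothesis Hsg : 0 < sg.

Definition weight (t : R) : R := / (sg ^ 2 + t ^ 2).

Lemma weight_den_pos (t : R) : 0 < sg ^ 2 + t ^ 2.
Proof. assert (0 < sg ^ 2) by (apply pow_lt; exact Hsg). assert (H1 := pow2_ge_0 t). lra. Qed.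

Lemma weight_pos (t : R) : 0 < weight t.
Proof. apply Rinv_0_lt_compat, weight_den_pos. Qed.

Lemma weight_le (t : R) : weight t <= / sg ^ 2.
Proof.
  apply Rinv_le_contravar; [apply pow_lt; exact Hsg|]. assert (H1 := pow2_ge_0 t). lra.
Qed.

Lemma weight_continuity (t : R) : continuity_pt weight t.
Proof.
  assert (H := weight_den_pos t).
  apply (continuity_pt_of_derive weight (fun t => - (2 * t) / (sg ^ 2 + t ^ 2) ^ 2)).
  unfold weight. auto_derive; [lra|]. field. lra.
Qed.

Lemma ex_RInt_weight (f : R -> R) (a b : R) :
  (forall t, continuity_pt f t) -> ex_RInt (fun t => f t * weight t) a b.
Proof.
  intros Hf. apply (@ex_RInt_continuous R_CompleteNormedModule). intros z _.
  apply continuous_of_pt, (continuity_pt_mult f weight); [apply Hf|apply weight_continuity].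
Qed.

Lemma continuity_pt_cos_dil (x t : R) : continuity_pt (fun t => cos (x * t)) t.
Proof.
  apply (continuity_pt_of_derive _ (fun t => - x * sin (x * t))). auto_derive; [trivial|ring].
Qed.

Lemma continuity_pt_id_sin (x t : R) : continuity_pt (fun t => t * sin (x * t)) t.
Proof.
  apply (continuity_pt_of_derive _ (fun t => sin (x * t) + t * (x * cos (x * t)))).
  auto_derive; [trivial|ring].
Qed.

(** The transform of the weight, truncated because a second derivative under the integral sign
    brings in [t ^ 2 * weight t], which tends to 1 and is not integrable on the line. *)
Definition cosI (T x : R) : R := RInt (fun t => cos (x * t) * weight t) (- T) T.
Definition cosI_deriv (T x : R) : R := RInt (fun t => sin (x * t) * (- t * weight t)) (- T) T.

Lemma is_derive_cosI (T x : R) : is_derive (cosI T) x (cosI_deriv T x).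
Proof.
  replace (cosI_deriv T x) with (RInt (fun t => t * (- sin (x * t)) * weight t) (- T) T).
  - apply (is_derive_RInt_dilation cos (fun y => - sin y) weight).
    + intros y. auto_derive; [trivial|ring].
    + intros y. apply (continuity_pt_of_derive _ (fun y => - cos y)). auto_derive; [trivial|ring].
    + apply weight_continuity.
  - apply RInt_ext_R. intros t. ring.
Qed.

Lemma RInt_cos_dil (T x : R) : x <> 0 -> is_RInt (fun t => cos (x * t)) (- T) T (2 * sin (x * T) / x).
Proof.
  intros Hx.
  replace (2 * sin (x * T) / x) with (minus (sin (x * T) / x) (sin (x * - T) / x)).
  - apply (is_RInt_derive (fun t => sin (x * t) / x)).
    + intros t _. auto_derive; [trivial|]. field. exact Hx.
    + intros t _. apply continuous_of_pt, continuity_pt_cos_dil.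
  - unfold minus, plus, opp; simpl. replace (x * - T) with (- (x * T)) by ring.
    rewrite sin_neg. field. exact Hx.
Qed.

Lemma is_derive_cosI_deriv (T x : R) :
  x <> 0 -> is_derive (cosI_deriv T) x (sg ^ 2 * cosI T x - 2 * sin (x * T) / x).
Proof.
  intros Hx.
  replace (sg ^ 2 * cosI T x - 2 * sin (x * T) / x) with
    (RInt (fun t => t * cos (x * t) * (- t * weight t)) (- T) T).
  - apply (is_derive_RInt_dilation sin cos (fun t => - t * weight t)).
    + intros y. auto_derive; [trivial|ring].
    + intros y. apply (continuity_pt_of_derive _ (fun y => - sin y)). auto_derive; [trivial|ring].
    + intros t. apply (continuity_pt_mult (fun t => - t) weight); [|apply weight_continuity].
      apply (continuity_pt_of_derive _ (fun _ => - 1)). auto_derive; [trivial|ring].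
  - apply is_RInt_unique.
    (* From [- t ^ 2 * weight t = sg ^ 2 * weight t - 1]; the constant 1 integrates to the forcing
       term 2 sin(xT)/x. *)
    apply is_RInt_ext with (fun t => minus (scal (sg ^ 2) (cos (x * t) * weight t)) (cos (x * t))).
    + intros t _. unfold minus, plus, opp, scal; simpl. unfold mult; simpl.
      unfold weight. assert (H := weight_den_pos t). field. simpl in H. lra.
    + apply (is_RInt_minus (V := R_NormedModule)).
      * apply (is_RInt_scal (V := R_NormedModule)).
        apply (RInt_correct (V := R_CompleteNormedModule)).
        apply ex_RInt_weight. intros; apply continuity_pt_cos_dil.
      * now apply RInt_cos_dil.
Qed.

(** Crude in T but uniform in x. At fixed T this and [cosI_deriv_bound] force [damped_flux] to decay
    at infinity, which excludes the growing mode exp(sg x) of the ODE. *)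
Lemma cosI_bound (T x : R) : 0 <= T -> Rabs (cosI T x) <= 2 * T / sg ^ 2.
Proof.
  intros HT. replace (2 * T / sg ^ 2) with ((T - - T) * / sg ^ 2) by (unfold Rdiv; ring).
  apply abs_RInt_le_const; [lra| |].
  - apply ex_RInt_weight. intros; apply continuity_pt_cos_dil.
  - intros t _. rewrite Rabs_mult, (Rabs_pos_eq (weight t)) by apply Rlt_le, weight_pos.
    assert (H1 : Rabs (cos (x * t)) <= 1) by (apply Rabs_le, COS_bound).
    assert (H2 := weight_le t). assert (H3 := weight_pos t). assert (H4 := Rabs_pos (cos (x * t))).
    nra.
Qed.

Lemma cosI_deriv_bound (T x : R) : 0 <= T -> Rabs (cosI_deriv T x) <= 2 * T * (T / sg ^ 2).
Proof.
  intros HT. replace (2 * T * (T / sg ^ 2)) with ((T - - T) * (T * / sg ^ 2)) by (unfold Rdiv; ring).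
  apply abs_RInt_le_const; [lra| |].
  - apply ex_RInt_ext_R with (fun t => - (t * sin (x * t)) * weight t); [intros; ring|].
    apply ex_RInt_weight. intros t. apply (continuity_pt_opp (fun t => t * sin (x * t))).
    apply continuity_pt_id_sin.
  - intros t Ht. rewrite !Rabs_mult, Rabs_Ropp, (Rabs_pos_eq (weight t)) by apply Rlt_le, weight_pos.
    assert (H1 : Rabs (sin (x * t)) <= 1) by (apply Rabs_le, SIN_bound).
    assert (H2 := weight_le t). assert (H3 := weight_pos t). assert (H4 := Rabs_pos (sin (x * t))).
    assert (H5 : Rabs t <= T) by (apply Rabs_le; lra). assert (H6 := Rabs_pos t).
    assert (Rabs t * weight t <= T * / sg ^ 2) by (apply Rmult_le_compat; lra).
    assert (0 <= Rabs t * weight t) by (apply Rmult_le_pos; lra). nra.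
Qed.

(* With K = [cosI T], K'' - sg^2 K = - 2 sin (x T) / x, so the derivative of
   (K' + sg K) e^(- sg x) is - 2 e^(- sg x) sin (x T) / x.  [damped_flux_corrected] subtracts the
   boundary term of one integration by parts; what remains has total variation O(1/T) on
   [x, +oo[ and vanishes at infinity. *)
Definition damped_flux (T x : R) : R := (cosI_deriv T x + sg * cosI T x) * exp (- sg * x).
Definition damped_flux_corrected (T x : R) : R := damped_flux T x - 2 / T * (exp (- sg * x) / x) * cos (x * T).

Lemma is_derive_damped_flux (T x : R) :
  x <> 0 -> is_derive (damped_flux T) x (- 2 * (exp (- sg * x) / x) * sin (x * T)).
Proof.
  intros Hx. unfold damped_flux.
  assert (H1 := is_derive_cosI T x). assert (H2 := is_derive_cosI_deriv T x Hx).
  assert (H3 : is_derive (fun x => exp (- sg * x)) x (- sg * exp (- sg * x)))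
    by (auto_derive; [trivial|ring]).
  assert (H4 : is_derive (fun x => cosI_deriv T x + sg * cosI T x) x
    (sg ^ 2 * cosI T x - 2 * sin (x * T) / x + sg * cosI_deriv T x)).
  { apply (is_derive_plus (cosI_deriv T) (fun x => sg * cosI T x)); [exact H2|].
    now apply (is_derive_scal (cosI T)). }
  assert (H5 := is_derive_mult _ _ x _ _ H4 H3 Rmult_comm).
  replace (- 2 * (exp (- sg * x) / x) * sin (x * T)) with
    (plus (mult (sg ^ 2 * cosI T x - 2 * sin (x * T) / x + sg * cosI_deriv T x) (exp (- sg * x)))
       (mult (cosI_deriv T x + sg * cosI T x) (- sg * exp (- sg * x)))); [exact H5|].
  unfold plus, mult; simpl. field. exact Hx.
Qed.

Lemma is_derive_damped_flux_corrected (T x : R) :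
  T <> 0 -> x <> 0 ->
  is_derive (damped_flux_corrected T) x (2 / T * ((sg * x + 1) / x ^ 2 * exp (- sg * x)) * cos (x * T)).
Proof.
  intros HT Hx. unfold damped_flux_corrected.
  replace (2 / T * ((sg * x + 1) / x ^ 2 * exp (- sg * x)) * cos (x * T)) with
    (minus (- 2 * (exp (- sg * x) / x) * sin (x * T))
      (2 / T * (- ((sg * x + 1) / x ^ 2 * exp (- sg * x)) * cos (x * T)
        - exp (- sg * x) / x * (T * sin (x * T))))).
  - apply (is_derive_minus (damped_flux T)); [now apply is_derive_damped_flux|].
    auto_derive; [exact Hx|]. field. split; assumption.
  - unfold minus, plus, opp; simpl. field. split; assumption.
Qed.

Lemma damped_flux_corrected_variation (T x y : R) :
  0 < T -> 0 < x <= y ->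
  Rabs (damped_flux_corrected T y - damped_flux_corrected T x) <= 2 / T * (exp (- sg * x) / x - exp (- sg * y) / y).
Proof.
  intros HT Hxy.
  set (h := fun x => exp (- sg * x) / x).
  assert (HhD : forall z, 0 < z -> is_derive (fun z => 2 / T * h z) z
    (- (2 / T * ((sg * z + 1) / z ^ 2 * exp (- sg * z))))).
  { intros z Hz. unfold h. auto_derive; [lra|]. field. lra. }
  assert (Hpos : forall z, 0 < z -> 0 <= 2 / T * ((sg * z + 1) / z ^ 2 * exp (- sg * z))).
  { intros z Hz. apply Rmult_le_pos; [apply Rlt_le, Rdiv_lt_0_compat; lra|].
    apply Rmult_le_pos; [|apply Rlt_le, exp_pos].
    apply Rlt_le, Rdiv_lt_0_compat; [nra|apply pow_lt, Hz]. }
  (* Since |cos| <= 1, the derivative is at most that of -(2/T) h in modulus; adding (2/T) h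
     therefore makes both signs of the function nonincreasing. *)
  assert (H1 : damped_flux_corrected T y + 2 / T * h y <= damped_flux_corrected T x + 2 / T * h x).
  { apply (nonincreasing_of_derive (fun z => damped_flux_corrected T z + 2 / T * h z) (fun z =>
      2 / T * ((sg * z + 1) / z ^ 2 * exp (- sg * z)) * cos (z * T) +
      - (2 / T * ((sg * z + 1) / z ^ 2 * exp (- sg * z))))); [lra| |].
    - intros z Hz. apply (is_derive_plus (damped_flux_corrected T)); [apply is_derive_damped_flux_corrected; lra|apply HhD; lra].
    - intros z Hz. assert (Hp := Hpos z ltac:(lra)). assert (Hc := COS_bound (z * T)). nra. }
  assert (H2 : - damped_flux_corrected T y + 2 / T * h y <= - damped_flux_corrected T x + 2 / T * h x).
  { apply (nonincreasing_of_derive (fun z => - damped_flux_corrected T z + 2 / T * h z) (fun z =>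
      - (2 / T * ((sg * z + 1) / z ^ 2 * exp (- sg * z)) * cos (z * T)) +
      - (2 / T * ((sg * z + 1) / z ^ 2 * exp (- sg * z))))); [lra| |].
    - intros z Hz. apply (is_derive_plus (fun z => - damped_flux_corrected T z)); [|apply HhD; lra].
      apply (is_derive_opp (damped_flux_corrected T)), is_derive_damped_flux_corrected; lra.
    - intros z Hz. assert (Hp := Hpos z ltac:(lra)). assert (Hc := COS_bound (z * T)). nra. }
  fold (h x) (h y). apply Rabs_le. lra.
Qed.

Lemma damped_flux_corrected_vanishes (T eps : R) : 0 < T -> 0 < eps -> exists Y, forall y, Y <= y -> Rabs (damped_flux_corrected T y) <= eps.
Proof.
  intros HT He.
  set (B := 2 * T * (T / sg ^ 2) + sg * (2 * T / sg ^ 2) + 2 / T).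
  assert (Hs2 : 0 < sg ^ 2) by (apply pow_lt, Hsg).
  assert (H2T : 0 < 2 / T) by (apply Rdiv_lt_0_compat; lra).
  assert (HB : 0 < B).
  { unfold B. assert (0 <= T / sg ^ 2) by (apply Rlt_le, Rdiv_lt_0_compat; lra).
    assert (0 <= 2 * T / sg ^ 2) by (apply Rlt_le, Rdiv_lt_0_compat; lra). nra. }
  (* From y >= 1 follows 1/y <= 1, and exp(sg y) >= sg y >= B/eps makes [B * exp (- sg * y)] at most
     eps. *)
  exists (Rmax 1 (B / eps / sg)). intros y Hy.
  assert (Hy1 : 1 <= y) by (eapply Rle_trans; [apply Rmax_l|exact Hy]).
  assert (Hy2 : B / eps / sg <= y) by (eapply Rle_trans; [apply Rmax_r|exact Hy]).
  assert (He1 : B * exp (- sg * y) <= eps).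
  { replace (- sg * y) with (- (sg * y)) by ring. rewrite exp_Ropp.
    apply Rmult_le_reg_r with (exp (sg * y)); [apply exp_pos|].
    rewrite Rmult_assoc, Rinv_l by (apply Rgt_not_eq, exp_pos).
    assert (H := exp_ineq1_le (sg * y)).
    assert (B <= eps * (sg * y)).
    { replace B with (eps * (sg * (B / eps / sg))) by (field; lra).
      apply Rmult_le_compat_l; [lra|]. apply Rmult_le_compat_l; lra. }
    nra. }
  eapply Rle_trans; [|exact He1]. unfold damped_flux_corrected, damped_flux.
  eapply Rle_trans; [apply Rabs_triang|]. rewrite Rabs_Ropp.
  assert (Hexp := exp_pos (- sg * y)).
  rewrite !Rabs_mult, (Rabs_pos_eq (exp _)) by lra.
  unfold B. rewrite Rmult_plus_distr_r. apply Rplus_le_compat.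
  - apply Rmult_le_compat_r; [lra|]. eapply Rle_trans; [apply Rabs_triang|].
    rewrite Rabs_mult, (Rabs_pos_eq sg) by lra.
    apply Rplus_le_compat; [apply cosI_deriv_bound; lra|]. apply Rmult_le_compat_l; [lra|apply cosI_bound; lra].
  - rewrite (Rabs_pos_eq (2 / T)) by lra. rewrite Rmult_assoc.
    apply Rmult_le_compat_l; [lra|].
    rewrite Rabs_pos_eq by (apply Rlt_le, Rdiv_lt_0_compat; lra).
    assert (Hc : Rabs (cos (y * T)) <= 1) by (apply Rabs_le, COS_bound).
    assert (Hd : exp (- sg * y) / y <= exp (- sg * y)).
    { apply Rmult_le_reg_r with y; [lra|]. unfold Rdiv. rewrite Rmult_assoc, Rinv_l by lra. nra. }
    assert (0 <= exp (- sg * y) / y) by (apply Rlt_le, Rdiv_lt_0_compat; lra).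
    assert (H4 := Rabs_pos (cos (y * T))). nra.
Qed.

(** One 2/T is the variation of the corrected flux from x to infinity, the other is the boundary
    term that was subtracted from it. *)
Lemma damped_flux_bound (T x : R) : 0 < T -> 0 < x -> Rabs (damped_flux T x) <= 4 / T * (exp (- sg * x) / x).
Proof.
  intros HT Hx.
  assert (H2T : 0 < 2 / T) by (apply Rdiv_lt_0_compat; lra).
  assert (Hh : forall z, 0 < z -> 0 < exp (- sg * z) / z)
    by (intros; apply Rdiv_lt_0_compat; [apply exp_pos|assumption]).
  assert (HN : Rabs (damped_flux_corrected T x) <= 2 / T * (exp (- sg * x) / x)).
  { apply le_epsilon. intros eps He. destruct (damped_flux_corrected_vanishes T eps HT He) as [Y HY].
    set (y := Rmax x Y). assert (Hy := HY y (Rmax_r _ _)).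
    assert (Hxy : x <= y) by apply Rmax_l.
    assert (Hv := damped_flux_corrected_variation T x y HT ltac:(lra)).
    assert (Hhy := Hh y ltac:(lra)).
    assert (Rabs (damped_flux_corrected T x) <= Rabs (damped_flux_corrected T y) + Rabs (damped_flux_corrected T y - damped_flux_corrected T x)).
    { replace (damped_flux_corrected T x) with (damped_flux_corrected T y + - (damped_flux_corrected T y - damped_flux_corrected T x)) at 1 by ring.
      eapply Rle_trans; [apply Rabs_triang|]. rewrite Rabs_Ropp. lra. }
    nra. }
  replace (damped_flux T x) with (damped_flux_corrected T x + 2 / T * (exp (- sg * x) / x) * cos (x * T)) by (unfold damped_flux_corrected; ring).
  eapply Rle_trans; [apply Rabs_triang|].
  assert (Hhx := Hh x Hx).
  rewrite Rabs_mult, (Rabs_pos_eq (2 / T * _)) by nra.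
  assert (Hc : Rabs (cos (x * T)) <= 1) by (apply Rabs_le, COS_bound).
  assert (Hp : 0 < 2 / T * (exp (- sg * x) / x)) by nra.
  replace (4 / T) with (2 / T + 2 / T) by (field; lra). nra.
Qed.

(** The derivative of [cosI T x * exp (sg * x)] is [damped_flux T x * exp (2 * sg * x)], of order
    1/T away from 0. Thus the product is nearly constant in x, which is the exponential law of the
    limit. *)
Lemma cosI_exp_variation (T a b : R) :
  0 < T -> 0 < a <= b ->
  Rabs (cosI T b * exp (sg * b) - cosI T a * exp (sg * a)) <= 4 * exp (2 * sg * b) / (a * T) * b.
Proof.
  intros HT Hab.
  assert (HaT : 0 < a * T) by (apply Rmult_lt_0_compat; lra).
  assert (HD : 0 <= 4 * exp (2 * sg * b) / (a * T)).
  { apply Rlt_le, Rdiv_lt_0_compat; [|exact HaT]. generalize (exp_pos (2 * sg * b)); lra. }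
  apply Rle_trans with (4 * exp (2 * sg * b) / (a * T) * Rabs (a - b)).
  2:{ apply Rmult_le_compat_l; [exact HD|]. rewrite Rabs_left1; lra. }
  (* [bounded_variation] needs the derivative on an interval symmetric about its base point. Based
     at b this is [a, 2b - a], which stays away from 0; the bound t <= 2b - a explains the exponent
     2 sg b. *)
  rewrite <- Rabs_Ropp.
  replace (- (cosI T b * exp (sg * b) - cosI T a * exp (sg * a))) with
    (cosI T a * exp (sg * a) - cosI T b * exp (sg * b)) by ring.
  apply (bounded_variation (fun x => cosI T x * exp (sg * x)) (fun x => damped_flux T x * exp (2 * sg * x))).
  intros t Ht. rewrite (Rabs_left1 (a - b)) in Ht by lra. apply Rabs_le_between in Ht.
  split.
  - replace (damped_flux T t * exp (2 * sg * t)) with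
      (plus (mult (cosI_deriv T t) (exp (sg * t))) (mult (cosI T t) (sg * exp (sg * t)))).
    + apply (is_derive_mult (cosI T) (fun x => exp (sg * x))); [apply is_derive_cosI| |exact Rmult_comm].
      auto_derive; [trivial|ring].
    + unfold plus, mult; simpl. unfold damped_flux.
      replace (exp (sg * t)) with (exp (- sg * t) * exp (2 * sg * t)); [ring|].
      rewrite <- exp_plus. f_equal. ring.
  - rewrite Rabs_mult, (Rabs_pos_eq (exp _)) by apply Rlt_le, exp_pos.
    apply Rle_trans with (4 / T * (exp (- sg * t) / t) * exp (2 * sg * t)).
    + apply Rmult_le_compat_r; [apply Rlt_le, exp_pos|]. apply damped_flux_bound; lra.
    + replace (4 / T * (exp (- sg * t) / t) * exp (2 * sg * t)) with
        (4 / T * (exp (sg * t) / t)).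
      2:{ replace (exp (sg * t)) with (exp (- sg * t) * exp (2 * sg * t)).
          - field. lra.
          - rewrite <- exp_plus. f_equal. ring. }
      replace (4 * exp (2 * sg * b) / (a * T)) with (4 / T * (exp (2 * sg * b) / a))
        by (field; lra).
      apply Rmult_le_compat_l; [apply Rlt_le, Rdiv_lt_0_compat; lra|].
      apply Rmult_le_compat; [apply Rlt_le, exp_pos|apply Rlt_le, Rinv_0_lt_compat; lra| |].
      * apply Rlt_le, exp_increasing. nra.
      * apply Rinv_le_contravar; lra.
Qed.

(** * The transform at frequency 0 and the limit of large T *)

Lemma one_sub_cos_le (x : R) : 0 <= 1 - cos x <= x ^ 2 / 2.
Proof.
  assert (Hs : Rabs (sin (x / 2)) <= Rabs (x / 2)).
  { replace (sin (x / 2)) with (sin (x / 2) - sin 0) by (rewrite sin_0; ring).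
    replace (Rabs (x / 2)) with (1 * Rabs (x / 2 - 0)) by (rewrite Rminus_0_r; ring).
    apply (bounded_variation sin cos). intros t _. split.
    - auto_derive; [trivial|ring].
    - apply Rabs_le, COS_bound. }
  assert (Hc : cos x = 1 - 2 * sin (x / 2) * sin (x / 2)).
  { rewrite <- cos_2a_sin. f_equal. field. }
  apply Rsqr_le_abs_1 in Hs. unfold Rsqr in Hs. split; [nra|].
  rewrite Hc. nra.
Qed.

(** Since [t ^ 2 * weight t <= 1], the quadratic bound for 1 - cos costs a^2/2 per unit length. The
    error grows with T, so a has to be smaller than T^(-1/2) in order. *)
Lemma cosI_near_0 (T a : R) : 0 <= T -> Rabs (cosI T a - cosI T 0) <= a ^ 2 * T.
Proof.
  intros HT.
  replace (cosI T a - cosI T 0) with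
    (RInt (fun t => minus (cos (a * t) * weight t) (cos (0 * t) * weight t)) (- T) T).
  2:{ apply (RInt_minus (V := R_CompleteNormedModule));
      apply ex_RInt_weight; intros; apply continuity_pt_cos_dil. }
  replace (a ^ 2 * T) with ((T - - T) * (a ^ 2 / 2)) by field.
  apply abs_RInt_le_const; [lra| |].
  - apply (ex_RInt_minus (V := R_NormedModule));
      apply ex_RInt_weight; intros; apply continuity_pt_cos_dil.
  - intros t _. unfold minus, plus, opp; simpl. rewrite Rmult_0_l, cos_0.
    replace (cos (a * t) * weight t + - (1 * weight t)) with
      (- ((1 - cos (a * t)) * weight t)) by ring.
    assert (H := one_sub_cos_le (a * t)). assert (Hw := weight_pos t).
    rewrite Rabs_Ropp, Rabs_pos_eq by nra.
    apply Rle_trans with ((a * t) ^ 2 / 2 * weight t); [apply Rmult_le_compat_r; lra|].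
    assert (t ^ 2 * weight t <= 1).
    { apply Rmult_le_reg_r with (sg ^ 2 + t ^ 2); [apply weight_den_pos|].
      unfold weight. rewrite Rmult_assoc, Rinv_l by (apply Rgt_not_eq, weight_den_pos).
      assert (0 < sg ^ 2) by (apply pow_lt, Hsg). lra. }
    replace ((a * t) ^ 2 / 2 * weight t) with (a ^ 2 / 2 * (t ^ 2 * weight t)) by (simpl; field).
    assert (0 <= a ^ 2) by apply pow2_ge_0. nra.
Qed.

Lemma cosI_at_0 (T : R) : cosI T 0 = 2 / sg * atan (T / sg).
Proof.
  apply is_RInt_unique.
  replace (2 / sg * atan (T / sg)) with (minus (atan (T / sg) / sg) (atan (- T / sg) / sg)).
  - apply (is_RInt_derive (fun t => atan (t / sg) / sg)).
    + intros t _. auto_derive; [lra|]. rewrite Rmult_0_l, cos_0. unfold weight.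
      assert (H := weight_den_pos t). field. split; [|lra]. simpl in H. intros E. nra.
    + intros t _. apply continuous_of_pt.
      apply (continuity_pt_mult (fun t => cos (0 * t)) weight);
        [apply continuity_pt_cos_dil|apply weight_continuity].
  - unfold minus, plus, opp; simpl. replace (- T / sg) with (- (T / sg)) by (field; lra).
    rewrite atan_opp. field. lra.
Qed.

Lemma atan_inv_lim : is_lim (fun T => atan (T / sg)) p_infty (PI / 2).
Proof.
  apply is_lim_le_le_loc with (fun T => PI / 2 - sg / T) (fun _ => PI / 2).
  - exists sg. intros T HT.
    assert (Hp : 0 < T / sg) by (apply Rdiv_lt_0_compat; lra).
    assert (E := atan_inv (T / sg) Hp).
    replace (/ (T / sg)) with (sg / T) in E by (field; lra).
    split; [|apply Rlt_le; apply atan_bound].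
    assert (Ha : atan (sg / T) <= sg / T).
    { assert (H : atan (sg / T) - sg / T <= atan 0 - 0).
      { apply (nonincreasing_of_derive (fun x => atan x - x) (fun x => / (1 + x ^ 2) - 1)).
        - apply Rlt_le, Rdiv_lt_0_compat; lra.
        - intros x _. auto_derive; [trivial|]. 
          unfold Rsqr. simpl. rewrite Rmult_1_r. ring.
        - intros x _. assert (H := pow2_ge_0 x).
          rewrite <- Rinv_1 at 2. apply Rle_minus, Rinv_le_contravar; lra. }
      rewrite atan_0 in H. lra. }
    lra.
  - replace (Finite (PI / 2)) with (Rbar_minus (PI / 2) 0) by (simpl; f_equal; ring).
    apply is_lim_minus'; [apply is_lim_const|].
    replace 0 with (sg * 0) by ring. 
    apply (is_lim_scal_l (fun T => / T) sg p_infty 0).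
    apply (is_lim_inv (fun T => T) p_infty p_infty); [apply is_lim_id|discriminate].
  - apply is_lim_const.
Qed.

Lemma cosI_0_lim : is_lim (fun T => cosI T 0) p_infty (PI / sg).
Proof.
  apply is_lim_ext with (fun T => 2 / sg * atan (T / sg)); [intros; now rewrite cosI_at_0|].
  replace (Finite (PI / sg)) with (Rbar_mult (2 / sg) (PI / 2)) by (simpl; f_equal; field; lra).
  apply is_lim_scal_l, atan_inv_lim.
Qed.

(* [cosI_exp_variation] is used down to [a = T^(-3/4)], where both error terms vanish as T grows. *)
Lemma cosI_exp_close (b S : R) :
  0 < b -> 1 <= S -> / b <= S ->
  Rabs (cosI (S ^ 4) b * exp (sg * b) - cosI (S ^ 4) 0) <=
    (4 * exp (2 * sg * b) * b + PI * exp sg + 1) * / S.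
Proof.
  intros Hb HS HbS.
  (* The fourth power avoids fractional exponents: a T = S and a^2 T = S^(-2). *)
  set (T := S ^ 4). set (a := / S ^ 3).
  assert (HS3 : 0 < S ^ 3) by (apply pow_lt; lra).
  assert (HT : 0 < T) by (apply pow_lt; lra).
  assert (Ha : 0 < a) by (apply Rinv_0_lt_compat; exact HS3).
  assert (HSS : S <= S ^ 3) by nra.
  assert (HaS : a <= / S) by (apply Rinv_le_contravar; lra).
  assert (Hab : a <= b).
  { eapply Rle_trans; [exact HaS|]. rewrite <- (Rinv_inv b).
    apply Rinv_le_contravar; [now apply Rinv_0_lt_compat|exact HbS]. }
  assert (Ha1 : a <= 1) by (rewrite <- Rinv_1; eapply Rle_trans; [exact HaS|]; apply Rinv_le_contravar; lra).
  assert (H1 := cosI_exp_variation T a b HT (conj Ha Hab)).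
  assert (H2 := cosI_near_0 T a (Rlt_le _ _ HT)).
  assert (EaT : a * T = S) by (unfold a, T; field; lra).
  assert (Ea2T : a ^ 2 * T <= / S).
  { replace (a ^ 2 * T) with (a * S) by (rewrite <- EaT; ring).
    unfold a. apply Rmult_le_reg_r with (S ^ 3); [exact HS3|]. field_simplify; [|lra|lra]. nra. }
  rewrite EaT in H1.
  assert (HK : Rabs (cosI T a) <= PI / sg).
  { apply Rle_trans with (cosI T 0).
    - unfold cosI.
      apply Rle_trans with (RInt (fun t => Rabs (cos (a * t) * weight t)) (- T) T).
      + apply abs_RInt_le; [lra|]. apply ex_RInt_weight; intros; apply continuity_pt_cos_dil.
      + apply RInt_le; [lra| | |].
        * apply (ex_RInt_norm (fun t => cos (a * t) * weight t)).
          apply ex_RInt_weight; intros; apply continuity_pt_cos_dil.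
        * apply ex_RInt_weight; intros; apply continuity_pt_cos_dil.
        * intros t _. rewrite Rmult_0_l, cos_0, Rabs_mult.
          rewrite (Rabs_pos_eq (weight t)) by apply Rlt_le, weight_pos.
          apply Rmult_le_compat_r; [apply Rlt_le, weight_pos|]. apply Rabs_le, COS_bound.
    - rewrite cosI_at_0. replace (PI / sg) with (2 / sg * (PI / 2)) by (field; lra).
      apply Rmult_le_compat_l; [apply Rlt_le, Rdiv_lt_0_compat; lra|].
      apply Rlt_le; apply atan_bound. }
  assert (He : 0 <= exp (sg * a) - 1 <= sg * exp sg * / S).
  { assert (E1 := exp_ineq1_le (sg * a)). assert (E2 := exp_ineq1_le (- (sg * a))).
    rewrite exp_Ropp in E2. assert (Hep := exp_pos (sg * a)).
    assert (E3 : exp (sg * a) <= exp sg).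
    { destruct (Req_dec (sg * a) sg) as [->|Hn]; [lra|]. apply Rlt_le, exp_increasing. nra. }
    assert (E4 : (1 - sg * a) * exp (sg * a) <= 1).
    { apply Rle_trans with (/ exp (sg * a) * exp (sg * a)).
      - apply Rmult_le_compat_r; lra.
      - rewrite Rinv_l; lra. }
    assert (Hsa : 0 < sg * a) by nra.
    split; [lra|].
    apply Rle_trans with (sg * a * exp sg).
    - assert (sg * a * exp (sg * a) <= sg * a * exp sg) by (apply Rmult_le_compat_l; lra). lra.
    - assert (0 < sg * exp sg) by (generalize (exp_pos sg); nra). nra. }
  (* Transport from b to a, then removal of the factor exp(sg a), then passage from a to 0. *)
  replace (cosI T b * exp (sg * b) - cosI T 0) with
    ((cosI T b * exp (sg * b) - cosI T a * exp (sg * a)) + (cosI T a * (exp (sg * a) - 1) + (cosI T a - cosI T 0)))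
    by ring.
  eapply Rle_trans; [apply Rabs_triang|].
  eapply Rle_trans; [apply Rplus_le_compat_l, Rabs_triang|].
  rewrite Rabs_mult, (Rabs_pos_eq (exp (sg * a) - 1)) by lra.
  assert (Rabs (cosI T a) * (exp (sg * a) - 1) <= PI / sg * (sg * exp sg * / S)).
  { apply Rmult_le_compat; [apply Rabs_pos|lra|exact HK|lra]. }
  replace (PI / sg * (sg * exp sg * / S)) with (PI * exp sg * / S) in H by (field; lra).
  unfold Rdiv in H1. lra.
Qed.

(** [cosI T b * exp (sg * b)] stays within O(T^(-1/4)) of [cosI T 0], whose limit is pi/sg. *)
Lemma cosI_lim_pos (b : R) : 0 < b -> is_lim (fun T => cosI T b) p_infty (PI / sg * exp (- sg * b)).
Proof.
  intros Hb. set (C := 4 * exp (2 * sg * b) * b + PI * exp sg + 1).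
  assert (HS : is_lim (fun T => C * / sqrt (sqrt T)) p_infty 0).
  { replace (Finite 0) with (Rbar_mult C 0) by (simpl; f_equal; ring).
    apply is_lim_scal_l.
    apply (is_lim_inv (fun T => sqrt (sqrt T)) p_infty p_infty); [|discriminate].
    apply is_lim_sqrt_p, is_lim_sqrt_p, is_lim_id. }
  assert (Hloc : Rbar_locally' p_infty (fun T =>
    Rabs (cosI T b * exp (sg * b) - cosI T 0) <= C * / sqrt (sqrt T))).
  { set (m := Rmax 1 (/ b)). exists (m ^ 4). intros T HT.
    assert (Hm1 : 1 <= m) by apply Rmax_l. assert (Hm2 : / b <= m) by apply Rmax_r.
    assert (Hm4 : 0 < m ^ 4) by (apply pow_lt; lra).
    assert (ET : T = sqrt (sqrt T) ^ 4).
    { replace (sqrt (sqrt T) ^ 4) with ((sqrt (sqrt T) * sqrt (sqrt T)) * (sqrt (sqrt T) * sqrt (sqrt T))) by ring.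
      rewrite sqrt_sqrt by apply sqrt_pos. rewrite sqrt_sqrt; lra. }
    assert (HmS : m <= sqrt (sqrt T)).
    { apply Rsqr_incr_0_var; [|apply sqrt_pos]. rewrite Rsqr_sqrt by apply sqrt_pos.
      apply Rsqr_incr_0_var; [|apply sqrt_pos]. rewrite Rsqr_sqrt by lra.
      unfold Rsqr. simpl in HT. lra. }
    rewrite ET at 1 2. apply cosI_exp_close; lra. }
  apply is_lim_ext with (fun T => exp (- sg * b) * (cosI T b * exp (sg * b))).
  { intros T. replace (- sg * b) with (- (sg * b)) by ring. rewrite exp_Ropp. field.
    apply Rgt_not_eq, exp_pos. }
  replace (Finite (PI / sg * exp (- sg * b))) with (Rbar_mult (exp (- sg * b)) (PI / sg))
    by (simpl; f_equal; ring).
  apply is_lim_scal_l.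
  apply is_lim_le_le_loc with (fun T => cosI T 0 - C * / sqrt (sqrt T))
                              (fun T => cosI T 0 + C * / sqrt (sqrt T)).
  - revert Hloc. apply filter_imp. intros T H. apply Rabs_le_between in H. lra.
  - replace (Finite (PI / sg)) with (Finite (PI / sg - 0)) by (f_equal; ring).
    apply is_lim_minus'; [apply cosI_0_lim|exact HS].
  - replace (Finite (PI / sg)) with (Finite (PI / sg + 0)) by (f_equal; ring).
    apply is_lim_plus'; [apply cosI_0_lim|exact HS].
Qed.

Lemma cosI_lim (b : R) : is_lim (fun T => cosI T b) p_infty (PI / sg * exp (- sg * Rabs b)).
Proof.
  destruct (Rtotal_order b 0) as [Hb|[->|Hb]].
  - rewrite Rabs_left by exact Hb.
    apply is_lim_ext with (fun T => cosI T (- b)); [|apply cosI_lim_pos; lra].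
    intros T. apply RInt_ext_R. intros t. f_equal.
    rewrite <- cos_neg. f_equal. ring.
  - rewrite Rabs_R0, Rmult_0_r, exp_0, Rmult_1_r. apply cosI_0_lim.
  - rewrite Rabs_pos_eq by lra. now apply cosI_lim_pos.
Qed.

End Kernel.

(** * The mean square of eta(s)/s *)

Lemma RInt_subinterval_le (f : R -> R) (a b c d : R) :
  (forall x y, ex_RInt f x y) -> (forall t, 0 <= f t) ->
  c <= a -> a <= b -> b <= d -> RInt f a b <= RInt f c d.
Proof.
  intros Hex Hf Hca Hab Hbd.
  assert (E1 := RInt_Chasles (V := R_CompleteNormedModule) f c a b (Hex _ _) (Hex _ _)).
  assert (E2 := RInt_Chasles (V := R_CompleteNormedModule) f c b d (Hex _ _) (Hex _ _)).
  unfold plus in E1, E2; simpl in E1, E2.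
  assert (H1 := RInt_ge_0 f c a Hca (Hex _ _) ltac:(intros; apply Hf)).
  assert (H2 := RInt_ge_0 f b d Hbd (Hex _ _) ltac:(intros; apply Hf)).
  lra.
Qed.

Section MeanSquare.

Variable sg : R.
Hypothesis Hsg : 0 < sg.

(* Only symmetric truncations are used: for nonnegative [f] they control every interval. *)
Definition has_mean (f : R -> R) (v : R) : Prop :=
  (forall t, continuity_pt f t) /\
  is_lim (fun T => RInt (fun t => f t * weight sg t) (- T) T) p_infty v.

Lemma has_mean_ext (f g : R -> R) (v w : R) :
  (forall t, f t = g t) -> v = w -> has_mean f v -> has_mean g w.
Proof.
  intros Hfg <- [Hc Hl]. split.
  - intros t. apply continuity_pt_ext with (2 := Hc t). exact Hfg.
  - apply is_lim_ext with (2 := Hl). intros T. apply RInt_ext_R. intros t. now rewrite Hfg.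
Qed.

Lemma has_mean_plus (f g : R -> R) (v w : R) :
  has_mean f v -> has_mean g w -> has_mean (fun t => f t + g t) (v + w).
Proof.
  intros [Hf Hv] [Hg Hw]. split.
  - intros t. now apply (continuity_pt_plus f g).
  - apply is_lim_ext with (fun T => RInt (fun t => f t * weight sg t) (- T) T
                                     + RInt (fun t => g t * weight sg t) (- T) T).
    + intros T.
      rewrite <- (RInt_plus (V := R_CompleteNormedModule)) by now apply ex_RInt_weight.
      apply RInt_ext_R. intros t. unfold plus; simpl. ring.
    + now apply is_lim_plus'.
Qed.

Lemma has_mean_scal (c : R) (f : R -> R) (v : R) :
  has_mean f v -> has_mean (fun t => c * f t) (c * v).
Proof.
  intros [Hf Hv]. split.
  - intros t. now apply (continuity_pt_scal f c).
  - apply is_lim_ext with (fun T => c * RInt (fun t => f t * weight sg t) (- T) T).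
    + intros T.
      transitivity (RInt (fun t => scal c (f t * weight sg t)) (- T) T).
      * symmetry. apply (RInt_scal (V := R_CompleteNormedModule)). now apply ex_RInt_weight.
      * apply RInt_ext_R. intros t. unfold scal; simpl. unfold mult; simpl. ring.
    + apply (is_lim_scal_l _ c p_infty v). exact Hv.
Qed.

Lemma has_mean_cos (b : R) : has_mean (fun t => cos (b * t)) (PI / sg * exp (- sg * Rabs b)).
Proof. split; [apply continuity_pt_cos_dil|apply (cosI_lim sg Hsg)]. Qed.

Lemma has_mean_bound (f : R -> R) (v a b : R) :
  has_mean f v -> (forall t, 0 <= f t) -> a <= b -> RInt (fun t => f t * weight sg t) a b <= v.
Proof.
  intros [Hf Hv] H0 Hab.
  apply (is_lim_le_loc (fun _ => RInt (fun t => f t * weight sg t) a b)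
    (fun T => RInt (fun t => f t * weight sg t) (- T) T) p_infty
    (RInt (fun t => f t * weight sg t) a b) v); [|apply is_lim_const|exact Hv].
  exists (Rmax (- a) b). intros T HT.
  assert (- a <= Rmax (- a) b) by apply Rmax_l. assert (b <= Rmax (- a) b) by apply Rmax_r.
  apply RInt_subinterval_le; try lra.
  - intros; now apply ex_RInt_weight.
  - intros t. apply Rmult_le_pos; [apply H0|apply Rlt_le, weight_pos, Hsg].
Qed.

(** * Exact mean squares of finite blocks *)

Definition sgn (j : nat) : R := (-1) ^ j.
(** This is (n+1)^(-sg), the modulus of the n-th term on the line Re s = sg. *)
Definition damp (n : nat) : R := exp (- sg * lnS n).

Definition cos_sum (p L : nat) (t : R) : R :=
  rsum (fun j => sgn j * damp (p + j) * cos (lnS (p + j) * t)) L.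
Definition sin_sum (p L : nat) (t : R) : R :=
  rsum (fun j => sgn j * damp (p + j) * sin (lnS (p + j) * t)) L.
Definition sq_sum (p L : nat) (t : R) : R := cos_sum p L t ^ 2 + sin_sum p L t ^ 2.
Definition alt_real (p L : nat) : R := rsum (fun j => sgn j * damp (p + j) ^ 2) L.

(** The addition theorem merges each pair of products into the single cosine of frequency
    [lnS (p + j) - l]. With l the logarithm of the next index this is the cross term in the
    induction of [has_mean_sq_sum]. *)
Lemma has_mean_cross (p L : nat) (l : R) :
  has_mean (fun t => cos_sum p L t * cos (l * t) + sin_sum p L t * sin (l * t))
    (PI / sg * rsum (fun j => sgn j * damp (p + j) * exp (- sg * Rabs (lnS (p + j) - l))) L).
Proof.
  induction L as [|L IH].
  - apply has_mean_ext with (fun t => 0 * cos (0 * t)) (0 * (PI / sg * exp (- sg * Rabs 0))).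
    + intros t. unfold cos_sum, sin_sum. simpl. ring.
    + simpl. ring.
    + apply has_mean_scal, has_mean_cos.
  - eapply has_mean_ext; [| |apply has_mean_plus; [exact IH|
      apply (has_mean_scal (sgn L * damp (p + L))), (has_mean_cos (lnS (p + L) - l))]].
    + intros t. unfold cos_sum, sin_sum. simpl rsum.
      rewrite Rmult_minus_distr_r, cos_minus. ring.
    + simpl rsum. ring.
Qed.

Lemma sgn_sum (L : nat) : 2 * rsum sgn L = 1 - sgn L.
Proof. induction L as [|L IH]; unfold sgn in *; simpl in *; lra. Qed.

Lemma sgn_sq (L : nat) : sgn L * sgn L = 1.
Proof. unfold sgn. rewrite <- Rpow_mult_distr. replace (-1 * -1) with 1 by ring. apply pow1. Qed.

Lemma lnS_le (n m : nat) : (n <= m)%nat -> lnS n <= lnS m.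
Proof. intros H. apply ln_le; [apply INR_S_pos|apply le_INR; lia]. Qed.

(* The diagonal and the cross terms telescope: index L contributes
   [e^2 (1 + 2 sgn L * rsum sgn L) = sgn L * e^2] with [e = damp (p + L)]. *)
Lemma has_mean_sq_sum (p L : nat) : has_mean (sq_sum p L) (PI / sg * alt_real p L).
Proof.
  induction L as [|L IH].
  - apply has_mean_ext with (fun t => 0 * cos (0 * t)) (0 * (PI / sg * exp (- sg * Rabs 0))).
    + intros t. unfold sq_sum, cos_sum, sin_sum. simpl. ring.
    + unfold alt_real. simpl. ring.
    + apply has_mean_scal, has_mean_cos.
  - eapply has_mean_ext; [| |apply has_mean_plus; [exact IH|apply has_mean_plus;
      [apply (has_mean_scal (2 * sgn L * damp (p + L))), (has_mean_cross p L (lnS (p + L)))|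
       apply (has_mean_scal (damp (p + L) ^ 2)), (has_mean_cos 0)]]].
    + intros t. unfold sq_sum, cos_sum, sin_sum. simpl rsum.
      set (X := rsum _ L). set (Y := rsum _ L).
      rewrite Rmult_0_l, cos_0.
      assert (E := sin2_cos2 (lnS (p + L) * t)). unfold Rsqr in E.
      set (c := cos _) in *. set (s := sin _) in *.
      transitivity (X ^ 2 + Y ^ 2 + 2 * sgn L * damp (p + L) * (X * c + Y * s)
        + damp (p + L) ^ 2 * ((sgn L * sgn L) * (s * s + c * c))); [|ring].
      rewrite E, sgn_sq. ring.
    + rewrite Rabs_R0, Rmult_0_r, exp_0. unfold alt_real.
      change (rsum ?f (S L)) with (rsum f L + f L). cbv beta.
      (* For n <= m, n^(-sg) (m/n)^(-sg) = m^(-sg): the kernel replaces the smaller index by the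
         larger one, and only the signs still depend on j. *)
      rewrite (rsum_ext (fun j => sgn j * damp (p + j) * exp (- sg * Rabs (lnS (p + j) - lnS (p + L))))
        (fun j => damp (p + L) * sgn j)).
      * rewrite rsum_scal. set (A := rsum (fun j => sgn j * damp (p + j) ^ 2) L).
        change (rsum (fun j => sgn j) L) with (rsum sgn L).
        assert (E1 := sgn_sum L). assert (E2 := sgn_sq L).
        replace (rsum sgn L) with ((1 - sgn L) / 2) by lra.
        transitivity (PI / sg * (A + damp (p + L) ^ 2 * (sgn L - sgn L * sgn L + 1))).
        { field. lra. }
        rewrite E2. field. lra.
      * intros j Hj. assert (Hl := lnS_le (p + j) (p + L) ltac:(lia)).
        rewrite Rabs_left1 by lra. unfold damp.
        rewrite Rmult_assoc, <- exp_plus, Rmult_comm. f_equal. f_equal. ring.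
Qed.

Lemma alternating_bound (a : nat -> R) (L : nat) :
  (forall n, 0 <= a (S n) <= a n) -> 0 <= rsum (fun j => sgn j * a j) L <= a O.
Proof.
  revert a. induction L as [|L IH]; intros a Ha.
  - simpl. specialize (Ha O). lra.
  - rewrite rsum_shift.
    specialize (IH (fun n => a (S n)) (fun n => Ha (S n))).
    rewrite (rsum_ext _ (fun j => -1 * (sgn j * a (S j)))) by (intros; unfold sgn; simpl; ring).
    rewrite rsum_scal. unfold sgn in *. simpl pow in *. specialize (Ha O). lra.
Qed.

(** Leibniz's estimate. Through [has_mean_sq_sum] it bounds the mean square of a block by its first
    coefficient alone, whatever the length: the Cauchy estimate in L^2. *)
Lemma alt_real_bound (p L : nat) : 0 <= alt_real p L <= damp p ^ 2.
Proof.
  rewrite <- (Nat.add_0_r p) at 3. unfold alt_real.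
  apply (alternating_bound (fun j => damp (p + j) ^ 2)).
  intros n. split; [apply pow2_ge_0|]. apply pow_incr.
  split; [apply Rlt_le, exp_pos|]. apply exp_le_compat.
  assert (H := lnS_le (p + n) (p + S n) ltac:(lia)). nra.
Qed.

(** * Convergence on the vertical line, uniformly in t *)

Lemma npow_opp_polar (n : nat) (t : R) :
  npow n (- ((sg, t) : C))%C = (damp n * cos (lnS n * t), - (damp n * sin (lnS n * t))).
Proof.
  unfold npow, Rpow_C. change (ln (INR (S n))) with (lnS n).
  unfold Cexp, Copp, Cmult, RtoC, Re, Im; simpl fst; simpl snd.
  replace (- sg * lnS n - - t * 0) with (- sg * lnS n) by ring.
  replace (- sg * 0 + - t * lnS n) with (- (lnS n * t)) by ring.
  rewrite cos_neg, sin_neg. unfold damp. f_equal. ring.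
Qed.

Lemma alt_sum_polar (p L : nat) (t : R) :
  alt_sum p L (sg, t) = (cos_sum p L t, - sin_sum p L t).
Proof.
  unfold alt_sum, cos_sum, sin_sum. induction L as [|L IH].
  - simpl. unfold RtoC. f_equal. ring.
  - simpl csum. simpl rsum. rewrite IH, npow_opp_polar.
    unfold Cplus, Cmult, RtoC; simpl. unfold sgn. f_equal; ring.
Qed.

Lemma Cmod_alt_sum_sq (p L : nat) (t : R) : Cmod (alt_sum p L (sg, t)) ^ 2 = sq_sum p L t.
Proof. rewrite Cmod2_alt, alt_sum_polar. unfold sq_sum. simpl. ring. Qed.

Lemma Cmod_div_sq (z : C) (t : R) :
  Cmod (z / ((sg, t) : C))%C ^ 2 = Cmod z ^ 2 * weight sg t.
Proof.
  assert (Hne : ((sg, t) : C) <> RtoC 0) by (intros E; injection E; intros; lra).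
  rewrite Cmod_div by exact Hne. unfold Rdiv. rewrite Rpow_mult_distr. f_equal.
  rewrite pow_inv, Cmod2_alt. reflexivity.
Qed.

(** The derivative of e^(-xs) has modulus |s| e^(-sg x), whose integral over [u, v] is the
    right-hand side. The estimate is made for [Re (c * z)] with arbitrary c, so that a real
    monotonicity argument suffices. *)
Lemma Cexp_variation (s : C) (u v : R) :
  Re s = sg -> u <= v ->
  Cmod (Cexp (RtoC u * - s) - Cexp (RtoC v * - s))%C <=
    Cmod s / sg * (exp (- sg * u) - exp (- sg * v)).
Proof.
  intros Hs Huv.
  set (z := (Cexp (RtoC u * - s) - Cexp (RtoC v * - s))%C).
  assert (key : forall c : C, Re (c * z)%C <= Cmod c * (Cmod s / sg * (exp (- sg * u) - exp (- sg * v)))).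
  { intros c.
    assert (H : - Re (c * Cexp (RtoC v * - s))%C + Cmod c * Cmod s / sg * exp (- sg * v) <=
                - Re (c * Cexp (RtoC u * - s))%C + Cmod c * Cmod s / sg * exp (- sg * u)).
    { apply (nonincreasing_of_derive
        (fun x => - Re (c * Cexp (RtoC x * - s))%C + Cmod c * Cmod s / sg * exp (- sg * x))
        (fun x => - Re (c * - s * Cexp (RtoC x * - s))%C + - (Cmod c * Cmod s * exp (- sg * x)))
        u v Huv).
      - intros x _.
        apply (is_derive_plus (fun x => - Re (c * Cexp (RtoC x * - s))%C)).
        + apply (is_derive_opp (fun x => Re (c * Cexp (RtoC x * - s))%C)), is_derive_Re_Cexp.
        + auto_derive; [trivial|]. field. lra.
      - intros x _.
        assert (H := re_le_Cmod (c * - s * Cexp (RtoC x * - s))%C).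
        rewrite !Cmod_mult, Cmod_opp, Cmod_Cexp, Re_RtoC_mult in H.
        replace (x * Re (- s)%C) with (- sg * x) in H
          by (rewrite <- Hs; destruct s; unfold Re, Copp; simpl; ring).
        apply Rabs_le_between in H. lra. }
    replace (Re (c * z)%C) with (Re (c * Cexp (RtoC u * - s))%C - Re (c * Cexp (RtoC v * - s))%C)
      by (unfold z, Cminus; rewrite Cmult_plus_distr_l; unfold Re, Cmult, Cplus, Copp; simpl; ring).
    replace (Cmod c * (Cmod s / sg * (exp (- sg * u) - exp (- sg * v)))) with
      (Cmod c * Cmod s / sg * exp (- sg * u) - Cmod c * Cmod s / sg * exp (- sg * v))
      by (field; lra).
    lra. }
  destruct (Req_dec (Cmod z) 0) as [E|E].
  - rewrite E. apply Rmult_le_pos.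
    + apply Rmult_le_pos; [apply Cmod_ge_0|apply Rlt_le, Rinv_0_lt_compat, Hsg].
    + assert (H : exp (- sg * v) <= exp (- sg * u)) by (apply exp_le_compat; nra). lra.
  - assert (Hz : 0 < Cmod z) by (generalize (Cmod_ge_0 z); lra).
    (* With c the conjugate of z, [Re (c * z)] is |z|^2, and one factor |z| cancels. *)
    specialize (key (Cconj z)). rewrite Cmod_conj in key.
    rewrite Cmult_comm, <- Cmod2_conj in key.
    apply Rmult_le_reg_l with (Cmod z); [exact Hz|]. simpl in key. lra.
Qed.

(** Consecutive terms are paired, each pair costing |s|/sg times a drop of [damp]; the drops between
    pairs are nonnegative and complete the telescope. Even length leaves no term unpaired. *)
Lemma alt_sum_even_bound (p L : nat) (t : R) :
  Cmod (alt_sum p (2 * L) (sg, t)) <= Cmod (sg, t) / sg * (damp p - damp (p + 2 * L)).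
Proof.
  induction L as [|L IH].
  - simpl. unfold alt_sum; simpl. rewrite Cmod_0, Nat.add_0_r. lra.
  - replace (2 * S L)%nat with (S (S (2 * L))) by lia.
    replace (alt_sum p (S (S (2 * L))) (sg, t)) with
      (alt_sum p (2 * L) (sg, t) +
       (npow (p + 2 * L) (- ((sg, t) : C)) - npow (S (p + 2 * L)) (- ((sg, t) : C))))%C.
    + eapply Rle_trans; [apply Cmod_triangle|].
      assert (Hn : forall n, npow n (- ((sg, t) : C))%C = Cexp (RtoC (lnS n) * - ((sg, t) : C))%C).
      { intros n. unfold npow, Rpow_C. f_equal. unfold lnS. ring. }
      rewrite !Hn.
      assert (H := Cexp_variation (sg, t) (lnS (p + 2 * L)) (lnS (S (p + 2 * L))) eq_refl
        ltac:(apply lnS_le; lia)).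
      fold (damp (p + 2 * L)) (damp (S (p + 2 * L))) in H.
      assert (Hd : damp (p + S (S (2 * L))) <= damp (S (p + 2 * L))).
      { apply exp_le_compat. assert (H1 := lnS_le (S (p + 2 * L)) (p + S (S (2 * L))) ltac:(lia)). nra. }
      assert (Hk : 0 <= Cmod (sg, t) / sg).
      { apply Rmult_le_pos; [apply Cmod_ge_0|apply Rlt_le, Rinv_0_lt_compat, Hsg]. }
      nra.
    + unfold alt_sum. change (csum ?f (S (S (2 * L)))) with (csum f (2 * L) + f (2 * L)%nat + f (S (2 * L)))%C.
      cbv beta. rewrite pow_m1_even, pow_m1_odd.
      replace (RtoC (-1)) with (- RtoC 1)%C by (rewrite <- RtoC_opp; reflexivity).
      replace (p + S (2 * L))%nat with (S (p + 2 * L)) by lia. ring.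
Qed.

(** Division by s absorbs the growth |s| of the paired estimate and makes it uniform in t. *)
Lemma alt_sum_even_div_bound (p L : nat) (t : R) :
  Cmod (alt_sum p (2 * L) (sg, t) / ((sg, t) : C))%C <= damp p / sg.
Proof.
  assert (Hne : ((sg, t) : C) <> RtoC 0) by (intros E; injection E; intros; lra).
  assert (Hs : 0 < Cmod (sg, t)) by now apply Cmod_gt_0.
  rewrite Cmod_div by exact Hne.
  apply Rmult_le_reg_r with (Cmod (sg, t)); [exact Hs|].
  unfold Rdiv at 1. rewrite Rmult_assoc, Rinv_l, Rmult_1_r by lra.
  eapply Rle_trans; [apply alt_sum_even_bound|].
  replace (damp p / sg * Cmod (sg, t)) with (Cmod (sg, t) / sg * damp p) by (field; lra).
  apply Rmult_le_compat_l.
  - apply Rlt_le, Rdiv_lt_0_compat; assumption.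
  - assert (H := exp_pos (- sg * lnS (p + 2 * L))). unfold damp at 2. lra.
Qed.

Lemma alt_sum_split (n m : nat) (s : C) :
  alt_sum 0 (2 * (n + m)) s = (alt_sum 0 (2 * n) s + alt_sum (2 * n) (2 * m) s)%C.
Proof.
  replace (2 * (n + m))%nat with (2 * n + 2 * m)%nat by lia.
  generalize (2 * m)%nat. intros k. unfold alt_sum. induction k as [|k IH].
  - rewrite Nat.add_0_r. simpl csum. ring.
  - rewrite Nat.add_succ_r.
    change (csum ?f (S (2 * n + k))) with (csum f (2 * n + k) + f (2 * n + k)%nat)%C.
    change (csum ?f (S k)) with (csum f k + f k)%C. cbv beta. rewrite IH, !Nat.add_0_l, pow_add, pow_m1_even, Rmult_1_l.
    ring.
Qed.

Definition eta_line (t : R) : C := one_sub_two_pow_mul_zeta ((sg, t) : C).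
Definition partial_sq (N : nat) (t : R) : R := sq_sum 0 (2 * N) t * weight sg t.
Definition eta_sq (t : R) : R := Cmod (eta_line t / ((sg, t) : C))%C ^ 2.

Lemma eta_line_lim (t : R) : clim (fun N => alt_sum 0 (2 * N) (sg, t)) (eta_line t).
Proof. apply eta_lim. exact Hsg. Qed.

Lemma eta_partial_dist (N : nat) (t : R) :
  Cmod (eta_line t / ((sg, t) : C) - alt_sum 0 (2 * N) (sg, t) / ((sg, t) : C))%C
    <= damp (2 * N) / sg.
Proof.
  assert (H := clim_scal (/ ((sg, t) : C))%C _ _ (eta_line_lim t)).
  unfold Cdiv. rewrite (Cmult_comm (eta_line t)).
  apply clim_Cmod_le with (1 := H) (N := N). intros n Hn. cbv beta.
  replace n with (N + (n - N))%nat by lia. rewrite alt_sum_split.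
  replace (/ ((sg, t) : C) * (alt_sum 0 (2 * N) (sg, t) + alt_sum (2 * N) (2 * (n - N)) (sg, t)) -
    alt_sum 0 (2 * N) (sg, t) * / ((sg, t) : C))%C with
    (alt_sum (2 * N) (2 * (n - N)) (sg, t) / ((sg, t) : C))%C by (unfold Cdiv; ring).
  apply alt_sum_even_div_bound.
Qed.

Lemma partial_sq_alt (N : nat) (t : R) :
  partial_sq N t = Cmod (alt_sum 0 (2 * N) (sg, t) / ((sg, t) : C))%C ^ 2.
Proof. unfold partial_sq. now rewrite Cmod_div_sq, Cmod_alt_sum_sq. Qed.

Lemma damp_0 : damp 0 = 1.
Proof. unfold damp. rewrite lnS_0, Rmult_0_r. apply exp_0. Qed.

Lemma damp_le_1 (n : nat) : damp n <= 1.
Proof. rewrite <- damp_0. apply exp_le_compat. assert (H := lnS_le 0 n ltac:(lia)). nra. Qed.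

Lemma partial_sq_uniform (N : nat) (t : R) :
  Rabs (partial_sq N t - eta_sq t) <= 3 / sg ^ 2 * damp (2 * N).
Proof.
  rewrite partial_sq_alt. unfold eta_sq.
  assert (H1 := alt_sum_even_div_bound 0 N t). rewrite damp_0 in H1.
  assert (H2 := eta_partial_dist N t).
  set (x := (eta_line t / ((sg, t) : C))%C) in *.
  set (y := (alt_sum 0 (2 * N) (sg, t) / ((sg, t) : C))%C) in *.
  assert (Hx := Cmod_ge_0 x). assert (Hy := Cmod_ge_0 y).
  assert (H3 : Cmod x <= Cmod y + Cmod (x - y)%C).
  { eapply Rle_trans; [|apply Cmod_triangle]. apply Req_le; f_equal; ring. }
  assert (H4 : Cmod y <= Cmod x + Cmod (x - y)%C).
  { rewrite Cmod_sym. eapply Rle_trans; [|apply Cmod_triangle]. apply Req_le; f_equal; ring. }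
  assert (Hd := damp_le_1 (2 * N)). assert (Hd0 : 0 < damp (2 * N)) by apply exp_pos.
  assert (Hi : 0 < / sg) by now apply Rinv_0_lt_compat.
  (* The 3 is the bound for |x| + |y| in units of 1/sg: |y| <= 1/sg, and |x| exceeds |y| by at most
     1/sg. *)
  replace (3 / sg ^ 2 * damp (2 * N)) with (damp (2 * N) / sg * (3 * / sg)) by (field; lra).
  replace (Cmod y ^ 2 - Cmod x ^ 2) with ((Cmod y - Cmod x) * (Cmod y + Cmod x)) by ring.
  rewrite Rabs_mult.
  assert (damp (2 * N) / sg <= / sg) by (unfold Rdiv; nra).
  apply Rmult_le_compat; try apply Rabs_pos.
  - apply Rabs_le; lra.
  - rewrite Rabs_pos_eq by lra. unfold Rdiv in *. lra.
Qed.

Lemma damp_double_lim : is_lim_seq (fun N => damp (2 * N)) 0.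
Proof.
  apply (is_lim_seq_subseq damp 0 (fun N => (2 * N)%nat) double_eventually).
  now apply exp_lnS_lim.
Qed.

Lemma ex_RInt_partial_sq (N : nat) (a b : R) : ex_RInt (partial_sq N) a b.
Proof. apply ex_RInt_weight; [exact Hsg|]. apply (has_mean_sq_sum 0 (2 * N)). Qed.

(** Uniform convergence gives both the integrability of [eta_sq], also across the removable
    singularity when sg = 1, and the limit of the integrals. *)
Lemma eta_sq_RInt (a b : R) :
  exists If : R, is_lim_seq (fun N => RInt (partial_sq N) a b) If /\ is_RInt eta_sq a b If.
Proof.
  apply (filterlim_RInt (V := R_CompleteNormedModule) partial_sq a b eventually _ eta_sq
    (fun N => RInt (partial_sq N) a b)).
  - intros N. apply (RInt_correct (V := R_CompleteNormedModule)), ex_RInt_partial_sq.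
  - apply filterlim_locally. intros eps.
    assert (Hl : is_lim_seq (fun N => 3 / sg ^ 2 * damp (2 * N)) 0).
    { replace (Finite 0) with (Finite (3 / sg ^ 2 * 0)) by (f_equal; ring).
      apply (is_lim_seq_scal_l _ _ 0), damp_double_lim. }
    apply is_lim_seq_spec in Hl. specialize (Hl eps).
    revert Hl. apply filter_imp. intros N HN t.
    rewrite Rminus_0_r in HN.
    apply Rle_lt_trans with (3 / sg ^ 2 * damp (2 * N)).
    + apply partial_sq_uniform.
    + eapply Rle_lt_trans; [apply Rle_abs|exact HN].
Qed.

Definition eta_2sg : R := Re (one_sub_two_pow_mul_zeta (RtoC (2 * sg))).

Lemma alt_sum_real (L : nat) : alt_sum 0 L (RtoC (2 * sg)) = RtoC (alt_real 0 L).
Proof.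
  unfold alt_sum, alt_real. induction L as [|L IH]; [reflexivity|].
  change (csum ?f (S L)) with (csum f L + f L)%C.
  change (rsum ?f (S L)) with (rsum f L + f L). cbv beta.
  assert (E : npow (0 + L) (- RtoC (2 * sg))%C = RtoC (damp (0 + L) ^ 2)).
  { unfold npow, Rpow_C. change (ln (INR (S (0 + L)))) with (lnS (0 + L)).
    replace (- RtoC (2 * sg) * RtoC (lnS (0 + L)))%C with
      (RtoC (- sg * lnS (0 + L) + - sg * lnS (0 + L))).
    - rewrite Cexp_RtoC, exp_plus. f_equal. unfold damp. ring.
    - rewrite RtoC_plus, !RtoC_mult, !RtoC_opp.
      replace (RtoC 2) with (RtoC 1 + RtoC 1)%C by (rewrite <- RtoC_plus; f_equal; ring). ring. }
  rewrite E, IH, RtoC_plus, RtoC_mult. reflexivity.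
Qed.

Lemma eta_2sg_lim : is_lim_seq (fun N => alt_real 0 (2 * N)) eta_2sg.
Proof.
  assert (H := eta_lim (RtoC (2 * sg)) ltac:(simpl; lra)).
  apply clim_Re in H. revert H. apply is_lim_seq_ext. intros N. now rewrite alt_sum_real.
Qed.

Lemma eta_2sg_real : one_sub_two_pow_mul_zeta (RtoC (2 * sg)) = RtoC eta_2sg.
Proof.
  apply clim_unique with (fun N => alt_sum 0 (2 * N) (RtoC (2 * sg))).
  - apply eta_lim. simpl; lra.
  - apply clim_of_Re_Im.
    + apply is_lim_seq_ext with (2 := eta_2sg_lim). intros N. now rewrite alt_sum_real.
    + apply is_lim_seq_ext with (fun _ => 0); [|apply is_lim_seq_const].
      intros N. now rewrite alt_sum_real.
Qed.

Lemma eta_2sg_nonneg : 0 <= eta_2sg.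
Proof.
  apply (is_lim_seq_le (fun _ => 0) (fun N => alt_real 0 (2 * N)) 0 eta_2sg);
    [|apply is_lim_seq_const|apply eta_2sg_lim].
  intros N. apply alt_real_bound.
Qed.

(** * Two-sided bounds for the limit integral *)

Lemma sq_sum_nonneg (p L : nat) (t : R) : 0 <= sq_sum p L t.
Proof. unfold sq_sum. assert (H1 := pow2_ge_0 (cos_sum p L t)). assert (H2 := pow2_ge_0 (sin_sum p L t)). lra. Qed.

(** On the fixed interval each partial integral is at most its mean over the whole line, which is
    known exactly; then N tends to infinity on both sides. *)
Lemma eta_sq_upper (a b If : R) :
  a <= b -> is_RInt eta_sq a b If -> If <= PI / sg * eta_2sg.
Proof.
  intros Hab HI. destruct (eta_sq_RInt a b) as [I' [Hl HI']].
  assert (E : If = I').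
  { rewrite <- (is_RInt_unique (V := R_CompleteNormedModule) _ _ _ _ HI).
    apply (is_RInt_unique (V := R_CompleteNormedModule)), HI'. }
  rewrite E.
  apply (is_lim_seq_le (fun N => RInt (partial_sq N) a b) (fun N => PI / sg * alt_real 0 (2 * N))
    I' (PI / sg * eta_2sg)); [|exact Hl|].
  - intros N. apply has_mean_bound; [apply has_mean_sq_sum|apply sq_sum_nonneg|exact Hab].
  - apply (is_lim_seq_scal_l _ _ eta_2sg), eta_2sg_lim.
Qed.

(** The two sides differ from (y + z)^2 by a square. Under the integral this plays the part of the
    triangle inequality in L^2 without square roots of integrals. *)
Lemma sq_le_weighted (x y z e : R) :
  0 < e -> 0 <= x -> 0 <= y -> 0 <= z -> x <= y + z ->
  x ^ 2 <= (1 + e) * y ^ 2 + (1 + / e) * z ^ 2.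
Proof.
  intros He Hx Hy Hz H.
  apply Rle_trans with ((y + z) ^ 2); [apply pow_incr; lra|].
  replace ((1 + e) * y ^ 2 + (1 + / e) * z ^ 2) with
    ((y + z) ^ 2 + / e * (e * y - z) ^ 2) by (field; lra).
  assert (0 <= / e * (e * y - z) ^ 2); [|lra].
  apply Rmult_le_pos; [apply Rlt_le, Rinv_0_lt_compat, He|apply pow2_ge_0].
Qed.

(** The partial sum at N is the one at m + N minus a block starting at 2N. The mean square of the
    block is bounded independently of m, so m can tend to infinity on the fixed interval. *)
Lemma partial_sq_le_eta (N : nat) (e a b If : R) :
  0 < e -> a <= b -> is_RInt eta_sq a b If ->
  RInt (partial_sq N) a b <= (1 + e) * If + (1 + / e) * (PI / sg * damp (2 * N) ^ 2).
Proof.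
  intros He Hab HI. destruct (eta_sq_RInt a b) as [I' [Hl HI']].
  assert (E : If = I').
  { rewrite <- (is_RInt_unique (V := R_CompleteNormedModule) _ _ _ _ HI).
    apply (is_RInt_unique (V := R_CompleteNormedModule)), HI'. }
  rewrite E.
  set (D := (1 + / e) * (PI / sg * damp (2 * N) ^ 2)).
  assert (Hie : 0 < / e) by now apply Rinv_0_lt_compat.
  apply (is_lim_seq_le (fun _ => RInt (partial_sq N) a b)
    (fun m => (1 + e) * RInt (partial_sq (m + N)) a b + D)
    (RInt (partial_sq N) a b) ((1 + e) * I' + D)); [|apply is_lim_seq_const|].
  - intros m.
    set (r := fun t => sq_sum (2 * N) (2 * m) t * weight sg t).
    assert (Hr : ex_RInt r a b).
    { apply ex_RInt_weight; [exact Hsg|]. apply (has_mean_sq_sum (2 * N) (2 * m)). }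
    apply Rle_trans with
      (RInt (fun t => plus (scal (1 + e) (partial_sq (m + N) t)) (scal (1 + / e) (r t))) a b).
    + apply RInt_le; [exact Hab|apply ex_RInt_partial_sq| |].
      * apply (ex_RInt_plus (V := R_NormedModule)); apply (ex_RInt_scal (V := R_NormedModule));
          [apply ex_RInt_partial_sq|exact Hr].
      * intros t _. unfold plus, scal; simpl. unfold mult; simpl.
        unfold partial_sq, r.
        rewrite <- !Rmult_assoc, <- Rmult_plus_distr_r.
        apply Rmult_le_compat_r; [apply Rlt_le, weight_pos, Hsg|].
        rewrite <- !Cmod_alt_sum_sq.
        apply sq_le_weighted; try apply Cmod_ge_0; [exact He|].
        rewrite (Nat.add_comm m N), alt_sum_split, <- (Cmod_opp (alt_sum (2 * N) _ _)).
        eapply Rle_trans; [|apply Cmod_triangle]. apply Req_le; f_equal; ring.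
    + rewrite (RInt_plus (V := R_CompleteNormedModule));
        [|apply (ex_RInt_scal (V := R_NormedModule)), ex_RInt_partial_sq
         |now apply (ex_RInt_scal (V := R_NormedModule))].
      rewrite !(RInt_scal (V := R_CompleteNormedModule)); [|exact Hr|apply ex_RInt_partial_sq].
      unfold plus, scal; simpl. unfold mult; simpl.
      apply Rplus_le_compat_l. unfold D. apply Rmult_le_compat_l; [lra|].
      eapply Rle_trans; [apply has_mean_bound; [apply has_mean_sq_sum|apply sq_sum_nonneg|exact Hab]|].
      apply Rmult_le_compat_l; [|apply alt_real_bound].
      apply Rlt_le, Rdiv_lt_0_compat; [apply PI_RGT_0|exact Hsg].
  - apply is_lim_seq_plus'; [|apply is_lim_seq_const].
    apply (is_lim_seq_scal_l _ _ I').
    now apply (is_lim_seq_incr_n (fun m => RInt (partial_sq m) a b)).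
Qed.

(** N is fixed first and T0 is then taken from the mean value of that single finite sum. The four
    quarters of eps pay for the weight e, the block after 2N, the distance of [alt_real] from its
    limit, and the truncation to [-T, T]. *)
Lemma eta_sq_lower (eps : R) :
  0 < eps -> exists T0, 0 <= T0 /\ forall a b If, a < - T0 -> T0 < b ->
    is_RInt eta_sq a b If -> PI / sg * eta_2sg - eps < If.
Proof.
  intros Heps. set (I := PI / sg * eta_2sg).
  assert (Hpis : 0 < PI / sg) by (apply Rdiv_lt_0_compat; [apply PI_RGT_0|exact Hsg]).
  assert (HI0 : 0 <= I) by (apply Rmult_le_pos; [lra|apply eta_2sg_nonneg]).
  (* Chosen so that e I < eps/4; the 1 keeps the denominator positive when I is 0. *)
  set (e := eps / (4 * (I + 1))).
  assert (He : 0 < e) by (apply Rdiv_lt_0_compat; lra).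
  assert (HeI : e * I < eps / 4).
  { unfold e. apply Rmult_lt_reg_r with (4 * (I + 1)); [lra|].
    replace (eps / (4 * (I + 1)) * I * (4 * (I + 1))) with (eps * I) by (field; lra).
    replace (eps / 4 * (4 * (I + 1))) with (eps * I + eps) by field. lra. }
  assert (HN : exists N, (1 + / e) * (PI / sg * damp (2 * N) ^ 2) < eps / 4 /\
                         I - eps / 4 < PI / sg * alt_real 0 (2 * N)).
  { assert (L1 : is_lim_seq (fun N => (1 + / e) * (PI / sg * damp (2 * N) ^ 2)) 0).
    { replace (Finite 0) with (Finite ((1 + / e) * (PI / sg * (0 * 0)))) by (f_equal; ring).
      apply (is_lim_seq_scal_l _ _ (PI / sg * (0 * 0))), (is_lim_seq_scal_l _ _ (0 * 0)).
      apply is_lim_seq_ext with (fun N => damp (2 * N) * damp (2 * N)); [intros; ring|].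
      apply is_lim_seq_mult'; apply damp_double_lim. }
    assert (L2 : is_lim_seq (fun N => PI / sg * alt_real 0 (2 * N)) I)
      by (apply (is_lim_seq_scal_l _ _ eta_2sg), eta_2sg_lim).
    apply is_lim_seq_spec in L1, L2.
    destruct (L1 (mkposreal (eps / 4) ltac:(lra))) as [N1 H1].
    destruct (L2 (mkposreal (eps / 4) ltac:(lra))) as [N2 H2].
    exists (max N1 N2). specialize (H1 (max N1 N2) ltac:(lia)). specialize (H2 (max N1 N2) ltac:(lia)).
    simpl pos in H1, H2. apply Rabs_lt_between in H1, H2. split; lra. }
  destruct HN as [N [HN1 HN2]].
  destruct (has_mean_sq_sum 0 (2 * N)) as [_ HT].
  apply is_lim_spec in HT. destruct (HT (mkposreal (eps / 4) ltac:(lra))) as [T1 HT1].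
  exists (Rmax 0 T1). split; [apply Rmax_l|]. intros a b If Ha Hb HI.
  assert (Hm0 : 0 <= Rmax 0 T1) by apply Rmax_l. assert (Hm1 : T1 <= Rmax 0 T1) by apply Rmax_r.
  set (T := Rmin (- a) b).
  assert (HTm : Rmax 0 T1 < T) by (apply Rmin_glb_lt; lra).
  assert (HTa : T <= - a) by apply Rmin_l. assert (HTb : T <= b) by apply Rmin_r.
  specialize (HT1 T ltac:(lra)). simpl pos in HT1. apply Rabs_lt_between in HT1.
  assert (Hsub : RInt (partial_sq N) (- T) T <= RInt (partial_sq N) a b).
  { apply RInt_subinterval_le; try lra.
    - intros; apply ex_RInt_partial_sq.
    - intros t. apply Rmult_le_pos; [apply sq_sum_nonneg|apply Rlt_le, weight_pos, Hsg]. }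
  assert (Hle := partial_sq_le_eta N e a b If He ltac:(lra) HI).
  assert (Hup := eta_sq_upper a b If ltac:(lra) HI). fold I in Hup.
  unfold partial_sq at 1 in Hsub.
  assert (e * If <= e * I) by (apply Rmult_le_compat_l; lra).
  lra.
Qed.

Lemma eta_sq_RInt_gen :
  is_RInt_gen eta_sq (Rbar_locally m_infty) (Rbar_locally p_infty) (PI / sg * eta_2sg).
Proof.
  intros P [eps HP].
  destruct (eta_sq_lower eps (cond_pos eps)) as [T0 [HT0 Hlow]].
  apply (Filter_prod _ _ _ (fun a => a < - T0) (fun b => T0 < b)).
  - now exists (- T0).
  - now exists T0.
  - intros a b Ha Hb. destruct (eta_sq_RInt a b) as [If [_ HI]].
    exists If. split; [exact HI|]. apply HP.
    assert (H1 := Hlow a b If Ha Hb HI). assert (H2 := eta_sq_upper a b If ltac:(lra) HI).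
    change (Rabs (If - PI / sg * eta_2sg) < eps). 
    assert (H3 := cond_pos eps). apply Rabs_lt_between. lra.
Qed.

End MeanSquare.

Theorem theorem1 (sigma : R) (Hsigma : 0 < sigma) :
  exists I : R,
    is_RInt_gen
      (fun t : R =>
         (Cmod (one_sub_two_pow_mul_zeta ((sigma, t) : C) / ((sigma, t) : C))%C) ^ 2)
      (Rbar_locally m_infty) (Rbar_locally p_infty) I /\
    RtoC I =
      (RtoC (PI / sigma) * one_sub_two_pow_mul_zeta (RtoC (2 * sigma)))%C.
Proof.
  exists (PI / sigma * eta_2sg sigma). split.
  - exact (eta_sq_RInt_gen sigma Hsigma).
  - rewrite RtoC_mult. f_equal. symmetry. exact (eta_2sg_real sigma Hsigma).
Qed.
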